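(* Let $m\ge 2$, let $\mathcal{C}$ be the class of nonempty open, bounded, convex subsets of $\mathbb{R}^m$, and for $\Omega\in\mathcal{C}$ let $$G(\Omega)=\frac{T(\Omega)\,\Lambda(\Omega)}{P(\Omega)^{\frac{m}{m-1}}}.$$ Then $$\inf_{\Omega\in\mathcal{C}}G(\Omega)=0\qquad\text{and}\qquad \sup_{\Omega\in\mathcal{C}}G(\Omega)=\max_{\Omega\in\mathcal{C}}G(\Omega),$$ i.e. the supremum is attained by some set in $\mathcal{C}$.
   Context: $P(\Omega)$ is the (De Giorgi) perimeter of $\Omega$. The torsional rigidity is $T(\Omega)=\max_{\varphi\in H_0^1(\Omega)\setminus\{0\}}\frac{(\int_\Omega\varphi\,dx)^2}{\int_\Omega|\nabla\varphi|^2dx}$, equivalently $T(\Omega)=\int_\Omega w\,dx$, where $w\in H^1_0(\Omega)$ solves $-\Delta w=1$ in $\Omega$. The first Dirichlet eigenvalue is $\Lambda(\Omega)=\min_{\varphi\in H_0^1(\Omega)\setminus\{0\}}\frac{\int_\Omega|\nabla\varphi|^2dx}{\int_\Omega\varphi^2dx}$. *)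

(* Defs.v *)
From HB Require Import structures.
From mathcomp Require Import all_boot all_order all_algebra.
From mathcomp Require Import all_classical all_reals all_analysis.

Set Implicit Arguments.
Unset Strict Implicit.
Unset Printing Implicit Defensive.

Import Order.TTheory GRing.Theory Num.Theory.
Import numFieldNormedType.Exports.

Local Open Scope classical_set_scope.
Local Open Scope ring_scope.

(** Lebesgue measure on ['rV[R]_n], which the library only has for [n = 1]. *)

Section borel_rV.
Context {R : realType} (n : nat).

Definition rV_coord (i : 'I_n) (x : 'rV[R]_n) : measurableTypeR R := x 0 i.

Let rV_set0 : g_sigma_preimage rV_coord set0.
Proof. exact: sigma_algebra0. Qed.

Let rV_setC A : g_sigma_preimage rV_coord A -> g_sigma_preimage rV_coord (~` A).
Proof. exact: sigma_algebraC. Qed.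

Let rV_bigcup (F : (set 'rV[R]_n)^nat) :
  (forall i, g_sigma_preimage rV_coord (F i)) ->
  g_sigma_preimage rV_coord (\bigcup_i (F i)).
Proof. exact: sigma_algebra_bigcup. Qed.

(* The sigma-algebra generated by the coordinates is the Borel one, the
   topology of ['rV[R]_n] being the product topology with [n] factors. *)
HB.instance Definition _ := @isMeasurable.Build default_measure_display
  'rV[R]_n (g_sigma_preimage rV_coord) rV_set0 rV_setC rV_bigcup.

Lemma measurable_rV_coord (i : 'I_n) : measurable_fun setT (rV_coord i).
Proof.
move=> _ Y mY; rewrite setTI; apply: sub_sigma_algebra => /=.
rewrite -bigcup_seq/=; exists i => /=; first by rewrite mem_index_enum.
by exists Y => //; rewrite setTI.
Qed.

Lemma measurable_fun_rV d (T : measurableType d) (f : T -> 'rV[R]_n) :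
  (forall i, measurable_fun setT (rV_coord i \o f)) -> measurable_fun setT f.
Proof.
move=> mf.
have sub : g_sigma_preimage rV_coord `<=` [set B | measurable (f @^-1` B)].
  apply: smallest_sub.
    split.
    - by rewrite /= preimage_set0.
    - by move=> B /= mB; rewrite setTD preimage_setC; exact: measurableC.
    - by move=> F /= mF; rewrite preimage_bigcup; exact: bigcupT_measurable.
  move=> B; rewrite -bigcup_seq => -[i _ [C mC <-]] /=; rewrite setTI.
  by have := mf i measurableT C mC; rewrite setTI.
by move=> _ A mA; rewrite setTI; exact: sub.
Qed.

End borel_rV.

Definition cons_rV {R : realType} {n : nat}
  (p : measurableTypeR R * 'rV[R]_n) : 'rV[R]_n.+1 :=
  row_mx (const_mx p.1 : 'rV_1) p.2.

Lemma cons_rV0 {R : realType} {n : nat} (p : measurableTypeR R * 'rV[R]_n) :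
  cons_rV p 0 ord0 = p.1.
Proof.
have := row_mxEl (const_mx p.1 : 'rV_1) p.2 0 ord0; rewrite [RHS]mxE => <-.
by congr (row_mx _ _ _ _); exact: val_inj.
Qed.

Lemma cons_rV_lift {R : realType} {n : nat} (p : measurableTypeR R * 'rV[R]_n)
  (j : 'I_n) : cons_rV p 0 (lift ord0 j) = p.2 0 j.
Proof.
rewrite -(row_mxEr (const_mx p.1 : 'rV_1) p.2 0 j).
by congr (row_mx _ _ _ _); exact: val_inj.
Qed.

Lemma measurable_cons_rV {R : realType} {n : nat} :
  measurable_fun setT (@cons_rV R n).
Proof.
apply: measurable_fun_rV => i; case: (unliftP ord0 i) => [j|] ->.
- rewrite (_ : _ \o _ = rV_coord j \o snd).
    by apply: measurableT_comp => //; exact: measurable_rV_coord.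
  by apply/funext => p; exact: cons_rV_lift.
- rewrite (_ : _ \o _ = fst); first exact: measurable_fst.
  by apply/funext => p; exact: cons_rV0.
Qed.

Section lebesgue_cons.
Context {R : realType} {n : nat}.
Variable mu : {measure set 'rV[R]_n -> \bar R}.

Definition lebesgue_cons : set 'rV[R]_n.+1 -> \bar R :=
  pushforward (lebesgue_measure \x^ mu)%E cons_rV.

Let mcons := @measurable_cons_rV R n.

Let lebesgue_cons0 : lebesgue_cons set0 = 0.
Proof. exact: measure0. Qed.

Let lebesgue_cons_ge0 A : (0 <= lebesgue_cons A)%E.
Proof. exact: measure_ge0. Qed.

Let lebesgue_cons_sigma_additive : semi_sigma_additive lebesgue_cons.
Proof. exact: measure_semi_sigma_additive. Qed.

HB.instance Definition _ := isMeasure.Build _ _ _ lebesgue_cons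
  lebesgue_cons0 lebesgue_cons_ge0 lebesgue_cons_sigma_additive.

End lebesgue_cons.

Fixpoint lebesgue_rV (R : realType) (n : nat) :
    {measure set 'rV[R]_n -> \bar R} :=
  if n is k.+1 then lebesgue_cons (lebesgue_rV R k) else \d_(0 : 'rV[R]_0).

Lemma measurable_rV_box (R : realType) (n : nat)
    (A : 'I_n -> set (measurableTypeR R)) : (forall i, measurable (A i)) ->
  measurable [set x : 'rV[R]_n | forall i, A i (x 0 i)].
Proof.
move=> mA.
rewrite (_ : [set _ | _] = \bigcap_(i in setT) (rV_coord i @^-1` A i)).
  apply: fin_bigcap_measurable => [|i _]; first exact: finite_finset.
  have := @measurable_rV_coord R n i measurableT _ (mA i).
  by rewrite setTI.
by apply/seteqP; split=> x /= Ax i => [_|]; exact: Ax.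
Qed.

(* On boxes, [lebesgue_rV] is the product of the side lengths. *)
Lemma lebesgue_rV_box (R : realType) (n : nat)
    (A : 'I_n -> set (measurableTypeR R)) : (forall i, measurable (A i)) ->
  lebesgue_rV R n [set x | forall i, A i (x 0 i)] =
  (\prod_(i < n) lebesgue_measure (A i))%E.
Proof.
elim: n A => [|n IHn] A mA.
  by rewrite big_ord0 /= diracE mem_set// => -[].
rewrite big_ord_recl -IHn// /= /lebesgue_cons /pushforward.
set B := [set x : 'rV[R]_n | forall i, A (lift ord0 i) (x 0 i)].
rewrite (_ : _ @^-1` _ = A ord0 `*` B).
  have mB : measurable B.
    exact: (@measurable_rV_box R n (A \o lift ord0)) (fun i => mA _).
  by rewrite product_measure2E.
apply/seteqP; split => [[a v] Aav|[a v] [/= Aa Bv] i].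
  split=> [|i] /=; first by have := Aav ord0; rewrite cons_rV0.
  by have := Aav (lift ord0 i); rewrite cons_rV_lift.
case: (unliftP ord0 i) => [j|] ->; first by rewrite cons_rV_lift; exact: Bv.
by rewrite cons_rV0.
Qed.

Section torsion_eigenvalue.
Context {R : realType} {m : nat}.
Local Notation E := 'rV[R]_m.
Local Notation mu := (lebesgue_rV R m).
Implicit Types (Omega : set E) (u f phi : E -> R) (g psi : E -> E) (i : 'I_m).

Definition partial i f : E -> R := fun x => 'D_(delta_mx 0 i) f x.

Fixpoint Ck (k : nat) f : Prop :=
  continuous f /\
  if k is j.+1 then
    forall i, (forall x, derivable f x (delta_mx 0 i)) /\ Ck j (partial i f)
  else True.

Definition smooth f : Prop := forall k, Ck k f.

Definition support_of {V : nmodType} (h : E -> V) : set E :=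
  closure [set x | h x != 0].

Definition test_function Omega phi : Prop :=
  [/\ smooth phi, compact (support_of phi) & support_of phi `<=` Omega].

Definition square_integrable Omega u : Prop :=
  measurable_fun Omega u /\ mu.-integrable Omega (fun x => (u x ^+ 2)%:E).

Definition weak_gradient Omega u g : Prop :=
  forall phi i, test_function Omega phi ->
    \int[mu]_(x in Omega) (u x * partial i phi x) =
    - \int[mu]_(x in Omega) (g x 0 i * phi x).

(* [u] is in H^1(Omega) and [g] is (a representative of) its gradient. *)
Definition H1 Omega u g : Prop :=
  [/\ square_integrable Omega u,
      forall i, square_integrable Omega (fun x => g x 0 i) &
      weak_gradient Omega u g].

(* H^1_0(Omega): closure of the test functions in the norm of H^1(Omega). *)
Definition H10 Omega u g : Prop :=
  H1 Omega u g /\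
  exists2 phi : nat -> E -> R, forall n, test_function Omega (phi n) &
    (fun n => \int[mu]_(x in Omega)
       ((phi n x - u x) ^+ 2 + \sum_i (partial i (phi n) x - g x 0 i) ^+ 2))
    @ \oo --> (0 : R).

(* [u] is nonzero as an element of L^2(Omega), i.e. up to null sets. *)
Definition nonzero_on Omega u : Prop :=
  ~ {ae mu, forall x, Omega x -> u x = 0}.

Definition dirichlet Omega g : R :=
  \int[mu]_(x in Omega) \sum_i g x 0 i ^+ 2.

(* The maximum and the minimum of the two quotients on H^1_0(Omega) minus 0,
   taken in [\bar R] as supremum and infimum so that no attainment result is
   needed to define them. *)
Definition torsion Omega : \bar R :=
  ereal_sup [set t | exists u g, [/\ H10 Omega u g, nonzero_on Omega u &
    t = ((\int[mu]_(x in Omega) u x) ^+ 2 / dirichlet Omega g)%:E]].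

Definition first_eigenvalue Omega : \bar R :=
  ereal_inf [set t | exists u g, [/\ H10 Omega u g, nonzero_on Omega u &
    t = (dirichlet Omega g / \int[mu]_(x in Omega) u x ^+ 2)%:E]].

Definition divergence psi : E -> R :=
  fun x => \sum_i partial i (fun y => psi y 0 i) x.

(* De Giorgi: the total variation in R^m of the indicator of [Omega]. The
   pointwise bound is on the Euclidean norm; the library's norm on ['rV_m] is
   the max norm. *)
Definition perimeter Omega : \bar R :=
  ereal_sup [set t | exists psi,
    [/\ forall i, Ck 1 (fun x => psi x 0 i),
        compact (support_of psi),
        forall x, \sum_i psi x 0 i ^+ 2 <= 1 &
        t = (\int[mu]_(x in Omega) divergence psi x)%:E]].

Definition convex_domain Omega : Prop :=
  [/\ Omega !=set0, open Omega, bounded_set Omega & convex_set Omega].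

Definition G Omega : \bar R :=
  (torsion Omega * first_eigenvalue Omega /
   poweR (perimeter Omega) (m%:R / (m%:R - 1))%R)%E.

End torsion_eigenvalue.

(* Main.v *)
Require Import Defs.
From HB Require Import structures.
From mathcomp Require Import all_boot all_order all_algebra.
From mathcomp Require Import all_classical all_reals all_analysis.
From mathcomp Require Import measurable_realfun ring lra.

Set Implicit Arguments.
Unset Strict Implicit.
Unset Printing Implicit Defensive.

Import Order.TTheory GRing.Theory Num.Theory.
Import numFieldNormedType.Exports.

Local Open Scope classical_set_scope.
Local Open Scope ring_scope.

(**
By Cauchy-Schwarz [(int phi)^2 <= |Omega| int phi^2], so
[T(Omega) Lambda(Omega) <= |Omega|]. If [Omega] is disjoint from its translate
[Omega + t e], where [e] is a basis vector, then [|Omega| <= t P(Omega)]: for a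
test function [chi] on [Omega] with values in [[0, 1]], the function
[F(s) = int_Omega chi(x + s e) dx] satisfies [F' >= - P(Omega)] and [F(t) = 0],
so that [int_Omega chi <= t P(Omega)]. Hence
[G(Omega) <= (t^m / |Omega|)^(1 / (m - 1))] for such a [t]. Long boxes
therefore have small [G].

Conversely, if [G(Omega) > a] then [Omega] has chords of length comparable to
[|Omega|^(1 / m)] in every coordinate direction. If moreover [Omega] is convex,
it contains a ball of radius comparable to [|Omega|^(1 / m)], and then it lies
in a concentric ball of comparable radius. Up to a similarity, under which [G]
is invariant, such domains contain a fixed ball and lie in the unit ball. In
place of Blaschke's selection theorem we take the limit [L] of a maximising
family along an ultrafilter: for every [s < 1], almost all members [Omega]
satisfy [s Omega <= L] and [s^2 L <= Omega]. Monotonicity and scaling of [T] and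
[Lambda], together with lower semicontinuity of [P], make [G] upper
semicontinuous along this limit, so that [L] is a maximiser.
*)

(** * Lebesgue measure and topology of row vectors *)

(** [T], [Lambda] and [P] are suprema or infima over functions or fields. [T] and [Lambda] are
    rewritten over test functions, by density in H^1_0. A larger domain then admits more competitors
    and a homothety acts on them by composition, which gives monotonicity and scaling. The exponent
    [m / (m - 1)] is the one for which the power of [P] scales like [T Lambda], that is, like
    volume.

    For the perimeter, which enters from below, semicontinuity comes from one fixed field, almost
    optimal for the limit: its divergence has nearly the same integral over all sets squeezed
    between two close homothetic copies of the limit.

    Values stay in the extended reals. The product [T Lambda] is finite through the volume, an
    infinite perimeter gives [G = 0], and the supremum may a priori be infinite.

    An ultrafilter decides every property of domains, so that finitely many decisions, one for each
    point of a net of the unit ball, yield both inclusions with the limit. The margin [(1 - s) r]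
    that convexity leaves around the points of [s Omega] pays for the distance to the net. *)

Section rV_norm.
Context {R : realType} {n : nat}.
Implicit Types (x y c : 'rV[R]_n).

Lemma ler_coord_norm x i : `|x 0 i| <= `|x|.
Proof.
rewrite [leRHS]/Num.Def.normr /= mx_normrE.
exact: (le_bigmax _ (fun ij : 'I_1 * 'I_n => `|x ij.1 ij.2|) (0, i)).
Qed.

Lemma rV_norm_le x (r : R) : 0 <= r -> (forall i, `|x 0 i| <= r) -> `|x| <= r.
Proof.
move=> r0 xr; rewrite [leLHS]/Num.Def.normr /= mx_normrE.
by apply/bigmax_leP; split=> // -[i j] _ /=; rewrite ord1.
Qed.

Lemma rV_norm_lt x (r : R) : 0 < r -> (forall i, `|x 0 i| < r) -> `|x| < r.
Proof.
move=> r0 xr; rewrite [ltLHS]/Num.Def.normr /= mx_normrE.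
by apply/bigmax_ltP; split=> // -[i j] _ /=; rewrite ord1.
Qed.

Lemma rV_norm_coord x : 0 < `|x| -> exists i, `|x 0 i| = `|x|.
Proof.
move=> x0; have : mx_norm x != 0 by rewrite gt_eqF.
by move=> /mx_norm_neq0 [[i j] /= xE]; exists j; rewrite -(ord1 i) -xE.
Qed.

Lemma norm_scale_delta (t : R) (i : 'I_n) :
  `|t *: (delta_mx 0 i : 'rV[R]_n)| = `|t|.
Proof.
apply/eqP; rewrite eq_le; apply/andP; split; last first.
  apply: le_trans (ler_coord_norm _ i); by rewrite !mxE !eqxx mulr1.
apply: rV_norm_le => // j; rewrite !mxE eqxx /= normrM.
by case: eqP; rewrite ?normr1 ?normr0 ?mulr1 ?mulr0.
Qed.

End rV_norm.

(** * Half-open boxes: generation of the Borel sets and uniqueness of the measure *)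

Section box_generation.
Context {R : realType}.

Definition oc_box {n} (a b : 'I_n -> R) : set 'rV[R]_n :=
  [set x | forall i, a i < x 0 i <= b i].

Lemma oc_boxE n (a b : 'I_n -> R) :
  oc_box a b =
  [set x : 'rV[R]_n | forall i, `]a i, b i]%classic (x 0 i : measurableTypeR R)].
Proof. by apply/seteqP; split=> x /= xab i; have := xab i; rewrite /= in_itv. Qed.

Lemma measurable_oc_box n (a b : 'I_n -> R) : measurable (oc_box a b).
Proof.
rewrite oc_boxE.
apply: (@measurable_rV_box R n (fun i => `]a i, b i]%classic)) => i.
exact: measurable_itv.
Qed.

Definition oc_boxes n : set (set 'rV[R]_n) :=
  [set A | exists a b : 'I_n -> R, A = oc_box a b].

Lemma setI_closed_oc_boxes n : setI_closed (@oc_boxes n).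
Proof.
move=> _ _ [a [b ->]] [c [d ->]].
exists (fun i => Num.max (a i) (c i)), (fun i => Num.min (b i) (d i)).
apply/seteqP; split=> [x [xab xcd] i|x xabcd].
  by rewrite gt_max le_min; have /andP[-> ->] := xab i; have /andP[-> ->] := xcd i.
by split=> i; have := xabcd i; rewrite gt_max le_min;
  case/andP => /andP[? ?] /andP[? ?]; apply/andP.
Qed.

Lemma oc_box_cover n :
  \bigcup_k oc_box (fun _ : 'I_n => - k%:R) (fun _ => k%:R : R) = setT.
Proof.
apply/seteqP; split=> // x _.
have [k xk] : exists k, `|x| < k%:R.
  by exists (Num.truncn `|x|).+1; rewrite truncnS_gt.
exists k => // i.
have := le_lt_trans (ler_coord_norm x i) xk.
by rewrite ltr_norml => /andP[-> /ltW ->].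
Qed.

(** A slab []a, b]] in one coordinate is the countable union of the boxes whose other sides are []-
    k, k]], and such slabs generate the coordinate sigma-algebra. *)
Lemma measurable_rV_generated n :
  (measurable : set (set 'rV[R]_n)) = <<s @oc_boxes n >>.
Proof.
apply/seteqP; split; last first.
  apply: smallest_sub; first exact: sigma_algebra_measurable.
  by move=> _ [a [b ->]]; exact: measurable_oc_box.
apply: smallest_sub; first exact: smallest_sigma_algebra.
move=> B; rewrite -bigcup_seq => -[i _ [C mC <-]]; rewrite setTI.
pose M : set (set (measurableTypeR R)) :=
  [set D | <<s @oc_boxes n >> (@rV_coord R n i @^-1` D)].
suff : (measurable : set (set (measurableTypeR R))) `<=` M by exact.
apply: smallest_sub.
  split.
  - by rewrite /M/= preimage_set0; exact: sigma_algebra0.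
  - by move=> D; rewrite /M/= => mD; rewrite setTD -preimage_setC -setTD;
      exact: sigma_algebraCD.
  - by move=> F; rewrite /M/= => mF; rewrite preimage_bigcup; exact: sigma_algebra_bigcup.
move=> D [[a b] _ <-]; rewrite /M/=.
rewrite (_ : _ @^-1` _ = \bigcup_k
   oc_box (fun j : 'I_n => if j == i then a else - k%:R)
          (fun j : 'I_n => if j == i then b else k%:R)).
  apply: sigma_algebra_bigcup => k; apply: sub_sigma_algebra.
  by eexists; eexists; reflexivity.
apply/seteqP; split=> x /=.
  rewrite in_itv/= => xab.
  have : [set: 'rV[R]_n] x by [].
  rewrite -oc_box_cover => -[k _ xk]; exists k => // j.
  by case: eqP => [->//|_]; exact: xk.
by move=> [k _ /(_ i)]; rewrite eqxx in_itv.
Qed.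

Lemma lebesgue_oc_box n (a b : 'I_n -> R) : (forall i, a i <= b i) ->
  lebesgue_rV R n (oc_box a b) = (\prod_i (b i - a i))%:E.
Proof.
move=> ab; rewrite oc_boxE.
rewrite (@lebesgue_rV_box R n (fun i => `]a i, b i]%classic)); last first.
  by move=> i; exact: measurable_itv.
rewrite -prodEFin; apply: eq_bigr => i _.
rewrite lebesgue_measure_itv/= lte_fin.
by have := ab i; rewrite le_eqVlt => /predU1P[->|->//]; rewrite ltxx subrr.
Qed.

Lemma oc_box_set0 n (a b : 'I_n -> R) i : b i <= a i -> oc_box a b = set0.
Proof.
move=> ba; apply/seteqP; split=> // x /(_ i) /andP[ax xb].
by have := lt_le_trans ax (le_trans xb ba); rewrite ltxx.
Qed.

Lemma lebesgue_rV_unique n (mu : {measure set 'rV[R]_n -> \bar R}) :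
  (forall a b : 'I_n -> R, (forall i, a i < b i) ->
    mu (oc_box a b) = (\prod_i (b i - a i))%:E) ->
  forall A, measurable A -> mu A = lebesgue_rV R n A.
Proof.
move=> muE.
apply: (@measure_unique _ _ _ (@oc_boxes n)
  (fun k => oc_box (fun _ : 'I_n => - k%:R) (fun _ => k%:R : R))).
- exact: measurable_rV_generated.
- exact: setI_closed_oc_boxes.
- by move=> k; eexists; eexists.
- exact: oc_box_cover.
- move=> _ [a [b ->]].
  have [ab|/forallPn/=[i]] := boolP [forall i, a i < b i].
    move/forallP in ab; rewrite muE//.
    by rewrite -(lebesgue_oc_box (fun i => ltW (ab i))).
  by rewrite -leNgt => ba; rewrite (oc_box_set0 ba) !measure0.
(* For [k = 0] the sides []0, 0]] make the box empty, except in dimension 0, where every box is the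
   whole one-point space and may be given the bounds 0 and 1. *)
- case=> [|k]; last first.
    rewrite muE ?ltry// => i; exact: (@lt_trans _ _ 0); rewrite ?oppr_lt0 ?ltr0n.
  case: n mu muE => [|n] mu muE.
    rewrite (_ : oc_box _ _ = oc_box (fun=> 0) (fun=> 1)).
      by rewrite muE ?ltry// => -[].
    by apply/seteqP; split=> x _ [].
  by rewrite (@oc_box_set0 _ _ _ ord0) ?measure0// mulr0n oppr0.
Qed.

End box_generation.

(** * Open sets as countable unions of cubes *)

Section open_sets.
Context {R : realType} {n : nat}.
Implicit Types (U : set 'rV[R]_n) (x y c : 'rV[R]_n).

Lemma open_rVP U :
  open U <-> forall x, U x -> exists2 e, 0 < e & forall y, `|y - x| < e -> U y.
Proof.
rewrite openE; split=> [oU x /oU|oU x /oU [e e0 eU]].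
  rewrite /interior/= => /nbhs_ballP[e /= e0 eU]; exists e => // y yx.
  by apply: eU; rewrite -ball_normE/= distrC.
apply/nbhs_ballP; exists e => // y.
by rewrite -ball_normE/= distrC; exact: eU.
Qed.

Lemma rat_approx x (e : R) : 0 < e ->
  exists q : 'rV[rat]_n, `|x - map_mx ratr q| < e.
Proof.
move=> e0.
have xq (i : 'I_n) : exists q : rat, `|x 0 i - ratr q| < e.
  have /rat_in_itvoo[q] : x 0 i - e < x 0 i + e by rewrite ltrD2l; lra.
  rewrite in_itv/= => /andP[xq qx]; exists q.
  by rewrite ltr_norml; apply/andP; split; lra.
have [q qE] := choice xq.
exists (\row_i q i); apply: rV_norm_lt => // i; rewrite !mxE; exact: qE.
Qed.

(** Enumerates the cubes with rational centre and radius [1 / (N + 1)]; radius 0 marks those that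
    are not inside [U]. The closed cubes lie in [U] while the open ones already cover it, which
    leaves room for compact supports. *)
Lemma open_cube_cover U : open U ->
  exists (c : nat -> 'rV[R]_n) (r : nat -> R),
    (forall k x, 0 < r k -> `|x - c k| <= r k -> U x) /\
    forall x, U x -> exists k, `|x - c k| < r k.
Proof.
move=> /open_rVP oU.
pose P (q : 'rV[rat]_n * nat) : Prop :=
  forall x, `|x - map_mx ratr q.1| <= q.2.+1%:R^-1 -> U x.
pose u k : 'rV[rat]_n * nat := odflt (0, 0%N) (unpickle k).
exists (fun k => map_mx ratr (u k).1).
exists (fun k => if `[< P (u k) >] then (u k).2.+1%:R^-1 else 0).
split=> [k x|x /oU [e e0 eU]].
  by case: asboolP => [Pk _ /Pk//|]; rewrite ltxx.
have [N N2] : exists N : nat, N.+1%:R^-1 < e / 2.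
  exists (Num.truncn (e / 2)^-1).
  rewrite -[ltRHS]invrK ltf_pV2 ?posrE ?ltr0n ?invr_gt0 ?divr_gt0//.
  by rewrite truncnS_gt.
have [q xq] := @rat_approx x N.+1%:R^-1 ltac:(by rewrite invr_gt0 ltr0n).
exists (pickle (q, N)); rewrite /u pickleK /=.
case: asboolP => // -[] y /= yq; apply: eU.
rewrite (_ : y - x = (y - map_mx ratr q) - (x - map_mx ratr q)); last first.
  by rewrite opprB addrA subrK.
apply: le_lt_trans (ler_normB _ _) _.
by rewrite (splitr e); apply: ler_ltD; [apply: le_trans yq (ltW N2)|apply: lt_trans xq N2].
Qed.

Lemma measurable_norm_le c (r : R) : measurable [set x | `|x - c| <= r].
Proof.
have [r0|r0] := leP 0 r; last first.
  rewrite [X in measurable X](_ : _ = set0)//; apply/seteqP; split=> x //= xr.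
  by have := le_lt_trans xr r0; rewrite ltNge normr_ge0.
rewrite [X in measurable X](_ : _ =
  [set x : 'rV[R]_n | forall i, `[c 0 i - r, c 0 i + r]%classic (x 0 i)]).
  apply: (@measurable_rV_box R n (fun i => `[c 0 i - r, c 0 i + r]%classic)).
  by move=> i; exact: measurable_itv.
apply/seteqP; split=> x /= xr.
  move=> i; have := le_trans (ler_coord_norm _ i) xr; rewrite !mxE in_itv/=.
  by rewrite ler_norml lerBlDl lerBrDr [- r + _]addrC lerBlDr => /andP[];
    rewrite addrC => ? ?; apply/andP; lra.
apply: rV_norm_le => // i; rewrite !mxE; have := xr i; rewrite in_itv/=.
by rewrite ler_norml => /andP[? ?]; apply/andP; lra.
Qed.

Lemma open_measurable_rV U : open U -> measurable U.
Proof.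
move=> /open_cube_cover[c [r [crU Ucr]]].
rewrite (_ : U = \bigcup_k (if 0 < r k then [set x | `|x - c k| <= r k] else set0)).
  apply: bigcupT_measurable => k; case: ifP => // _; exact: measurable_norm_le.
apply/seteqP; split=> [x /Ucr[k xk]|x [k _]].
  exists k => //; rewrite (le_lt_trans (normr_ge0 _) xk)/=; exact: ltW.
by case: ifPn => // rk; exact: crU.
Qed.

Lemma continuous_measurable_rV (f : 'rV[R]_n -> R) D :
  measurable D -> continuous f -> measurable_fun D f.
Proof.
move=> mD /continuousP cf; apply: (measurability _ (RGenOpens.measurableE R)).
move=> _ [_ [a [b ->] <-]]; apply: measurableI => //.
by apply: open_measurable_rV; exact/cf/interval_open.
Qed.

End open_sets.

(** * Change of variables under homotheties and translations *)

Section affine_change_of_variables.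
Context {R : realType} {n : nat}.
Local Notation E := 'rV[R]_n.
Local Notation mu := (lebesgue_rV R n).
Implicit Types (x v : E) (t : R) (A D : set E).

(** Homothetic copies are always preimages under [aff t v], that is [(Omega - v) / t]: openness and
    measurability are then those of preimages. *)
Definition aff t v x : E := t *: x + v.

Lemma affK t v : t != 0 -> cancel (aff t v) (aff t^-1 (- (t^-1 *: v))).
Proof.
by move=> t0 x; rewrite /aff scalerDr scalerA mulVf// scale1r addrK.
Qed.

Lemma affKV t v : t != 0 -> cancel (aff t^-1 (- (t^-1 *: v))) (aff t v).
Proof.
move=> t0 x; rewrite /aff scalerBr !scalerA divff// !scale1r subrK//.
Qed.

Lemma affB t v x y : aff t v x - aff t v y = t *: (x - y).
Proof. by rewrite /aff opprD addrACA subrr addr0 scalerBr. Qed.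

Lemma continuous_aff t v : continuous (aff t v).
Proof.
apply/continuousP => A /open_rVP oA; apply/open_rVP => x /= /oA[e e0 eA].
exists (e / (`|t| + 1)); first by rewrite divr_gt0// ltr_wpDl.
move=> y; rewrite ltr_pdivlMr ?ltr_wpDl// => yx; apply: eA.
rewrite affB normrZ; apply: le_lt_trans yx.
by rewrite mulrC ler_wpM2l// lerDl.
Qed.

Lemma measurable_aff t v : measurable_fun setT (aff t v).
Proof.
apply: measurable_fun_rV => i.
apply: (@continuous_measurable_rV R n (fun x => aff t v x 0 i)) => // x.
apply: (@continuous_comp _ _ _ (aff t v) (fun y : E => y 0 i)).
  exact: continuous_aff.
exact: coord_continuous.
Qed.

Let nng_expn t (t0 : 0 < t) : 0 <= t ^+ n.
Proof. by rewrite exprn_ge0// ltW. Qed.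

(** [t ^+ n] times the pushforward of [mu] gives every box its volume, so [lebesgue_rV_unique]
    identifies it with [mu]. *)
Lemma lebesgue_aff t v A : 0 < t -> measurable A ->
  mu A = ((t ^+ n)%:E * mu (aff t v @^-1` A))%E.
Proof.
move=> t0 mA; have mt := measurable_aff t v.
pose P : {measure set E -> \bar R} := pushforward mu (aff t v).
pose k : {nonneg R} := NngNum (nng_expn t0).
pose Q : {measure set E -> \bar R} := mscale k (P mt).
suff QE : forall A, measurable A -> Q A = mu A.
  by rewrite -QE.
apply: lebesgue_rV_unique => a b ab.
rewrite /Q /P /= /mscale /= /pushforward.
rewrite (_ : _ @^-1` _ =
  oc_box (fun i => t^-1 * (a i - v 0 i)) (fun i => t^-1 * (b i - v 0 i))).
  rewrite lebesgue_oc_box; last first.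
    by move=> i; rewrite ler_pM2l ?invr_gt0// lerD2r ltW.
  rewrite -EFinM; congr (_%:E).
  rewrite -[X in _ ^+ X]card_ord -prodr_const -big_split/=.
  apply: eq_bigr => i _; rewrite -mulrBr mulVKf ?gt_eqF//.
  by rewrite opprB addrA subrK.
by apply/seteqP; split=> x /= xab i; have := xab i;
  rewrite /aff !mxE ![t^-1 * _]mulrC ltr_pdivrMr// ler_pdivlMr// ltrBlDr lerBrDr;
  rewrite [_ * t]mulrC.
Qed.


Lemma ge0_integral_aff t v D (f : E -> \bar R) : 0 < t -> measurable D ->
  measurable_fun D f -> (forall x, D x -> (0 <= f x)%E) ->
  (\int[mu]_(x in D) f x =
   (t ^+ n)%:E * \int[mu]_(x in aff t v @^-1` D) f (aff t v x))%E.
Proof.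
move=> t0 mD mf f0; have mt := measurable_aff t v.
pose P : measure E R := pushforward mu (aff t v).
pose k : {nonneg R} := NngNum (nng_expn t0).
transitivity (\int[mscale k (P mt)]_(x in D) f x)%E.
  apply: eq_measure_integral => A mA AD.
  by rewrite [LHS](lebesgue_aff v t0).
rewrite ge0_integral_mscale//= /P ge0_integral_pushforward//.
by move=> y; rewrite inE; exact: f0.
Qed.

Lemma measurable_aff_preimage t v D : measurable D ->
  measurable (aff t v @^-1` D).
Proof. by move=> mD; rewrite -[X in measurable X]setTI; exact: measurable_aff. Qed.

Lemma measurable_fun_aff t v D (f : E -> R) : measurable D ->
  measurable_fun D f -> measurable_fun (aff t v @^-1` D) (f \o aff t v).
Proof.
move=> mD mf _ Y mY.
rewrite (_ : _ `&` _ = aff t v @^-1` (D `&` f @^-1` Y))//.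
by apply: measurable_aff_preimage; exact: mf.
Qed.

(** The law for nonnegative functions is applied to the positive and negative parts; integrability
    makes both integrals finite, so that [fine] commutes with the factor and the difference. *)
Lemma Rintegral_aff t v D (f : E -> R) : 0 < t -> measurable D ->
  mu.-integrable D (EFin \o f) ->
  \int[mu]_(x in D) f x =
  t ^+ n * \int[mu]_(x in aff t v @^-1` D) f (aff t v x).
Proof.
move=> t0 mD /integrableP[mf fi].
have pos (g : E -> \bar R) : measurable_fun D g ->
    (forall x, D x -> (0 <= g x)%E) -> (\int[mu]_(x in D) g x < +oo)%E ->
    exists2 r : R, (\int[mu]_(x in aff t v @^-1` D) g (aff t v x) = r%:E)%E &
                   (\int[mu]_(x in D) g x = (t ^+ n * r)%:E)%E.
  move=> mg g0 goo.
  have gE := ge0_integral_aff v t0 mD mg g0.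
  have I0 : (0 <= \int[mu]_(x in aff t v @^-1` D) g (aff t v x))%E.
    by apply: integral_ge0 => x; exact: g0.
  case: (\int[mu]_(x in aff t v @^-1` D) g (aff t v x))%E I0 gE => [r _ gE|_ gE|//].
    by exists r => //; rewrite gE.
  by move: goo; rewrite gE gt0_muley ?lte_fin ?exprn_gt0// ltxx.
have le_abs (g : E -> \bar R) : measurable_fun D g ->
    (forall x, D x -> (0 <= g x <= `|(EFin \o f) x|)%E) ->
    (\int[mu]_(x in D) g x < +oo)%E.
  move=> mg gf; apply: le_lt_trans fi; apply: ge0_le_integral => //.
  - by move=> x /gf /andP[].
  - exact: measurableT_comp.
  - by move=> x /gf /andP[].
have mp := measurable_funepos mf.
have mn := measurable_funeneg mf.
have [rp rpE rpD] :
    exists2 r : R, (\int[mu]_(x in aff t v @^-1` D) (EFin \o f)^\+ (aff t v x) = r%:E)%E &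
     (\int[mu]_(x in D) (EFin \o f)^\+ x = (t ^+ n * r)%:E)%E.
  apply: pos => //; apply: le_abs => // x Dx.
  have fE := congr1 (@^~ x) (fune_abse (EFin \o f)).
  by rewrite funepos_ge0 /= [leRHS]fE/= leeDl.
have [rn rnE rnD] :
    exists2 r : R, (\int[mu]_(x in aff t v @^-1` D) (EFin \o f)^\- (aff t v x) = r%:E)%E &
     (\int[mu]_(x in D) (EFin \o f)^\- x = (t ^+ n * r)%:E)%E.
  apply: pos => //; apply: le_abs => // x Dx.
  have fE := congr1 (@^~ x) (fune_abse (EFin \o f)).
  by rewrite funeneg_ge0 /= [leRHS]fE/= leeDr.
rewrite /Rintegral [in LHS]integralE [in RHS]integralE.
rewrite [X in fine (X - _)%E = _]rpD [X in fine (_ - X)%E = _]rnD.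
rewrite [X in _ * fine (X - _)%E](_ : _ = rp%:E); last first.
  by rewrite -rpE; apply: eq_integral => x _; rewrite !funeposE.
rewrite [X in _ * fine (_ - X)%E](_ : _ = rn%:E); last first.
  by rewrite -rnE; apply: eq_integral => x _; rewrite !funenegE.
by rewrite /= mulrBr.
Qed.

Lemma integrable_aff t v D (f : E -> R) : 0 < t -> measurable D ->
  mu.-integrable D (EFin \o f) ->
  mu.-integrable (aff t v @^-1` D) (EFin \o (f \o aff t v)).
Proof.
move=> t0 mD /integrableP[mf fi]; apply/integrableP; split.
  by apply/measurable_EFinP; apply: measurable_fun_aff => //; exact/measurable_EFinP.
move: fi; rewrite (ge0_integral_aff v t0)//; last exact: measurableT_comp.
have := @integral_ge0 _ _ _ mu (aff t v @^-1` D)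
  (fun x => `|(EFin \o f) (aff t v x)|%E) (fun x _ => abse_ge0 _).
rewrite (_ : EFin \o (f \o aff t v) = (EFin \o f) \o aff t v)//=.
move: (\int[mu]_(x in _) _)%E => [r _ _|_|//]; first exact: ltry.
by rewrite gt0_muley ?lte_fin ?exprn_gt0.
Qed.

End affine_change_of_variables.

Section lebesgue_bounds.
Context {R : realType} {n : nat}.
Local Notation E := 'rV[R]_n.
Local Notation mu := (lebesgue_rV R n).
Implicit Types (x c : E) (r : R) (A U : set E).

Definition cube c r : set E :=
  oc_box (fun i => c 0 i - r) (fun i => c 0 i + r).

Lemma measurable_cube c r : measurable (cube c r).
Proof. exact: measurable_oc_box. Qed.

Lemma lebesgue_cube c r : 0 <= r -> mu (cube c r) = ((r *+ 2) ^+ n)%:E.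
Proof.
move=> r0; rewrite lebesgue_oc_box => [|i]; last by lra.
congr (_%:E); rewrite -[X in _ ^+ X]card_ord -prodr_const.
by apply: eq_bigr => i _; ring.
Qed.

Lemma cube_norm_le c r x : 0 <= r -> cube c r x -> `|x - c| <= r.
Proof.
move=> r0 xcr; apply: rV_norm_le => // i; rewrite !mxE ler_norml.
by have /andP[? ?] := xcr i; apply/andP; lra.
Qed.

Lemma norm_lt_cube c r x : `|x - c| < r -> cube c r x.
Proof.
move=> xc i; have := le_lt_trans (ler_coord_norm _ i) xc.
by rewrite !mxE ltr_norml => /andP[? ?]; apply/andP; lra.
Qed.

Lemma bounded_rVP A :
  bounded_set A <-> exists2 r, 0 < r & forall x, A x -> `|x| <= r.
Proof.
split=> [[M [_ MA]]|[r r0 rA]].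
  exists (`|M| + 1) => [|x Ax]; first by rewrite ltr_wpDl.
  by apply: MA => //; rewrite (le_lt_trans (ler_norm M))// ltrDl.
exists r; split=> [|s rs x Ax]; first exact: num_real.
by apply: le_trans (rA _ Ax) (ltW rs).
Qed.

Lemma bounded_set_lebesgue_lty A : measurable A -> bounded_set A ->
  (mu A < +oo)%E.
Proof.
move=> mA /bounded_rVP[r r0 Ar].
apply: (@le_lt_trans _ _ (mu (cube 0 (r + 1)))).
  apply: le_measure; rewrite ?inE//; first exact: measurable_cube.
  by move=> x /Ar xr; apply: norm_lt_cube; rewrite subr0 (le_lt_trans xr)// ltrDl.
by rewrite lebesgue_cube ?ltry// addr_ge0// ltW.
Qed.

Lemma open_lebesgue_gt0 U : open U -> U !=set0 -> (0 < mu U)%E.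
Proof.
move=> oU [c Uc]; have mU := open_measurable_rV oU.
have /open_rVP /(_ c Uc)[e e0 eU] := oU.
apply: (@lt_le_trans _ _ (mu (cube c (e / 2)))).
  by rewrite lebesgue_cube ?lte_fin ?exprn_gt0 ?pmulrn_lgt0 ?divr_gt0// ltW// divr_gt0.
apply: le_measure; rewrite ?inE//; first exact: measurable_cube.
move=> x xc; apply: eU; have : `|x - c| <= e / 2.
  by apply: cube_norm_le => //; rewrite ltW// divr_gt0.
by move=> /le_lt_trans; apply; lra.
Qed.

Lemma bounded_integrable A (f : E -> R) (M : R) : measurable A ->
  (mu A < +oo)%E -> measurable_fun A f -> (forall x, A x -> `|f x| <= M) ->
  mu.-integrable A (EFin \o f).
Proof.
move=> mA Aoo mf fM; apply: measurable_bounded_integrable => //.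
exists M; split; first exact: num_real.
by move=> N MN x /= Ax; rewrite (le_trans (fM _ Ax))// ltW.
Qed.

End lebesgue_bounds.

(** * Smooth functions and integration by parts *)

Section flat_functions.
Context {R : realType}.
Implicit Types (u : R) (k : nat).

(* Up to constants, these are the derivatives of [exp (- 1 / u)]. *)
Definition flat k u : R := if 0 < u then u^-1 ^+ k * expR (- u^-1) else 0.

Lemma flat_ge0 k u : 0 <= flat k u.
Proof.
rewrite /flat; case: ifPn => // u0.
by rewrite mulr_ge0 ?expR_ge0// exprn_ge0// invr_ge0 ltW.
Qed.

Lemma flat0_gt0 u : 0 < u -> 0 < flat 0 u.
Proof. by move=> u0; rewrite /flat u0 expr0 mul1r expR_gt0. Qed.

Lemma flat_le0 k u : u <= 0 -> flat k u = 0.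
Proof. by rewrite /flat leNgt => /negbTE ->. Qed.

Lemma flat0_le1 u : flat 0 u <= 1.
Proof.
rewrite /flat; case: ifPn => // u0.
by rewrite expr0 mul1r -expR0 ler_expR oppr_le0 invr_ge0 ltW.
Qed.

(** With [y = 1 / u] this compares [y ^+ k.+1 / (k.+1)!] with the exponential series of [y]. It
    yields differentiability at 0. *)
Lemma flat_le_linear k u : 0 <= u -> flat k u <= (k.+1)`!%:R * u.
Proof.
rewrite le_eqVlt => /predU1P[<-|u0]; first by rewrite flat_le0// mulr0.
rewrite /flat u0; have y0 : 0 < u^-1 by rewrite invr_gt0.
rewrite -[X in _ <= _ * X]invrK; move: (u^-1) y0 => y y0.
rewrite ler_pdivlMr// mulrAC -exprSr expRN ler_pdivrMr ?expR_gt0//.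
rewrite -ler_pdivrMl ?ltr0n ?fact_gt0// mulrC.
by apply: le_trans (expR_ge1Dxn k (ltW y0)); rewrite lerDr.
Qed.

Lemma flatS k u : 0 < u -> u^-1 * flat k u = flat k.+1 u.
Proof. by move=> u0; rewrite /flat u0 exprS mulrA. Qed.

Lemma is_derive_flat k u :
  is_derive u 1 (flat k) (flat k.+2 u - k%:R * flat k.+1 u).
Proof.
have [u0|u0|->] := ltgtP u 0.
- rewrite !flat_le0 ?ltW// mulr0 subrr.
  have E : \near u, (cst 0 : R -> R) u = flat k u.
    near=> w; rewrite flat_le0//; apply: ltW; near: w; exact: lt_nbhsl.
  by split; [apply: (near_eq_derivable E)|rewrite -(near_eq_derive _ E) derive_cst].
- have E : \near u, (fun w : R => w^-1 ^+ k * expR (- w^-1)) u = flat k u.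
    near=> w; rewrite /flat ifT//; near: w; exact: lt_nbhsr.
  have Dinv : is_derive u 1 (fun w : R => w^-1) (- u ^- 2 *: 1).
    by apply: (is_deriveV (f := id)); rewrite ?gt_eqF.
  have D1 := is_deriveX k Dinv.
  have D2 : is_derive u 1 (expR \o (fun w : R => - w^-1)) (expR (- u^-1) * - (- u ^- 2 *: 1)).
    apply: is_derive1_comp; exact: is_deriveN.
  have D := is_deriveM D1 D2.
  have DE : (((fun w : R => w^-1) ^+ k) * (expR \o (fun w : R => - w^-1))) =
    (fun w : R => w^-1 ^+ k * expR (- w^-1)).
    by apply/funext => w; rewrite /= [LHS]/GRing.mul/= exprfctE.
  rewrite DE in D; case: D => D Dv.
  split; first exact: (near_eq_derivable E).
  rewrite -(near_eq_derive _ E) Dv /flat u0 /= /GRing.scale/=.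
  rewrite exprfctE -!exprVn; move: (u^-1) (expR _) => y z.
  by case: k {E D1 D DE Dv} => [|k]; rewrite ?mulr0n ?expr0 /= !exprS; ring.
(* At 0 the difference quotient is 0 on the left and [flat k.+1] on the right, which is at most
   linear. *)
- rewrite !flat_le0// mulr0 subrr.
  suff H : h^-1 *: ((flat k \o shift (0 : R)) (h *: 1) - flat k 0) @[h --> 0^'] --> (0 : R).
    by split; [apply/cvg_ex; exists 0|exact: cvg_lim].
  apply/cvgr0Pnorm_le => e e0.
  have C0 : (0 : R) < (k.+2)`!%:R by rewrite ltr0n fact_gt0.
  near=> h; rewrite /= addr0 /GRing.scale/= mulr1 (@flat_le0 _ 0)// subr0.
  have [h0|h0] := leP h 0; first by rewrite flat_le0// mulr0 normr0 ltW.
  rewrite flatS// ger0_norm ?flat_ge0//.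
  apply: le_trans (flat_le_linear _ (ltW h0)) _.
  rewrite -ler_pdivlMl//; apply: le_trans (ler_norm h) _.
  near: h; apply: nbhs_dnbhs.
  apply/nbhs_ballP; exists ((k.+2)`!%:R^-1 * e) => /=.
    by rewrite mulr_gt0// invr_gt0.
  by move=> h; rewrite /ball/= sub0r normrN => /ltW.
Unshelve. all: by end_near. Qed.

Lemma continuous_flat k : continuous (flat k).
Proof.
move=> u; apply: differentiable_continuous; apply/derivable1_diffP.
by have [] := is_derive_flat k u.
Qed.

End flat_functions.

(** * Directional derivatives and classes of smooth functions *)

Section directional.
Context {R : realType} {n : nat}.
Local Notation E := 'rV[R]_n.
Implicit Types (x v w : E) (f g : E -> R) (t : R).

Lemma is_derive_lineP f x v d : is_derive x v f d <->
  is_derive (0 : R) 1 (fun h : R => f (h *: v + x)) d.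
Proof.
have qE : (fun h : R => h^-1 *: (((fun s : R => f (s *: v + x)) \o shift 0) (h *: 1)
      - f (0 *: v + x))) = (fun h => h^-1 *: ((f \o shift x) (h *: v) - f x)).
  by apply/funext => h; rewrite /= scale0r add0r addr0 /GRing.scale/= mulr1.
by split=> -[d1 d2]; split; rewrite /derivable /derive ?qE//= -qE.
Qed.

Lemma is_derive_aff f t w x v d : is_derive (aff t w x) v f d ->
  is_derive x v (f \o aff t w) (t * d).
Proof.
move=> /is_derive_lineP fd; apply/is_derive_lineP.
rewrite (_ : (fun h => _) =
  (fun s : R => f (s *: v + aff t w x)) \o (fun h : R => t * h)).
  rewrite mulrC; apply: is_derive1_comp; first by rewrite mulr0.
  rewrite -[X in is_derive _ _ _ X](mulr1 t).
  rewrite (_ : (fun h => _) = (t \*: (id : R -> R))) //.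
  exact: is_deriveZ.
by apply/funext => h /=; rewrite /aff scalerDr scalerA addrA.
Qed.

Lemma is_derive_coord (phi : R -> R) (a c : R) (i : 'I_n) x v d :
  is_derive (a * x 0 i + c) 1 phi d ->
  is_derive x v (fun y : E => phi (a * y 0 i + c)) (a * v 0 i * d).
Proof.
move=> phid; apply/is_derive_lineP.
rewrite (_ : (fun h => _) =
  phi \o (fun h : R => (a * v 0 i) * h + (a * x 0 i + c))); last first.
  by apply/funext => h /=; rewrite !mxE; congr phi; ring.
rewrite [_ * d]mulrC; apply: is_derive1_comp; first by rewrite mulr0 add0r.
rewrite -[X in is_derive _ _ _ X]addr0 -[X in is_derive _ _ _ (X + _)]mulr1.
rewrite (_ : (fun h => _) = ((a * v 0 i) \*: (id : R -> R)) + cst (a * x 0 i + c))//.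
by apply: is_deriveD; exact: is_deriveZ.
Qed.

Lemma is_derive_line f v x s d : is_derive (x + s *: v) v f d ->
  is_derive s 1 (fun h : R => f (x + h *: v)) d.
Proof.
move=> /is_derive_lineP fd.
rewrite (_ : (fun h => _) =
  (fun h : R => f (h *: v + (x + s *: v))) \o (id + cst (- s))); last first.
  apply/funext => h /=; rewrite [(_ + _) h]/GRing.add/= scalerBl.
  by rewrite [in RHS]addrCA subrK.
rewrite -[d]mulr1; apply: is_derive1_comp.
  by rewrite [(_ + _) s]/GRing.add/= subrr.
by rewrite -[X in is_derive _ _ _ X]addr0; exact: is_deriveD.
Qed.

End directional.

Section smooth_functions.
Context {R : realType} {n : nat}.
Local Notation E := 'rV[R]_n.
Implicit Types (x v w : E) (f g : E -> R) (t a : R) (i : 'I_n).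

Lemma rV_continuousD f g : continuous f -> continuous g ->
  continuous (fun x => f x + g x).
Proof. by move=> cf cg x; exact: (continuousD (cf x) (cg x)). Qed.

Lemma rV_continuousM f g : continuous f -> continuous g ->
  continuous (fun x => f x * g x).
Proof. by move=> cf cg x; exact: (continuousM (cf x) (cg x)). Qed.

Lemma rV_continuousZ a f : continuous f -> continuous (fun x => a * f x).
Proof. by move=> cf; apply: rV_continuousM => //; exact: cst_continuous. Qed.

Lemma partialZ a f i : (forall x, derivable f x (delta_mx 0 i)) ->
  (forall x, derivable (fun y => a * f y) x (delta_mx 0 i)) /\
  partial i (fun y => a * f y) = (fun x => a * partial i f x).
Proof.
move=> df.
have D x : is_derive x (delta_mx 0 i) (a \*: f) (a *: partial i f x).
  by apply: is_deriveZ; exact/derivableP.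
by split=> [x|]; [have [] := D x|apply/funext => x; have [] := D x].
Qed.

Lemma partialM f g i : (forall x, derivable f x (delta_mx 0 i)) ->
  (forall x, derivable g x (delta_mx 0 i)) ->
  (forall x, derivable (fun y => f y * g y) x (delta_mx 0 i)) /\
  partial i (fun y => f y * g y) =
  (fun x => f x * partial i g x + partial i f x * g x).
Proof.
move=> df dg.
have D x : is_derive x (delta_mx 0 i) (f * g)
    (f x *: partial i g x + g x *: partial i f x).
  by apply: is_deriveM; exact/derivableP.
split=> [x|]; [by have [] := D x|apply/funext => x].
by have [_ DE] := D x; rewrite [RHS]addrC [X in X + _]mulrC addrC; exact: DE.
Qed.

Lemma partialD f g i : (forall x, derivable f x (delta_mx 0 i)) ->
  (forall x, derivable g x (delta_mx 0 i)) ->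
  (forall x, derivable (fun y => f y + g y) x (delta_mx 0 i)) /\
  partial i (fun y => f y + g y) = (fun x => partial i f x + partial i g x).
Proof.
move=> df dg.
have D x : is_derive x (delta_mx 0 i) (f + g) (partial i f x + partial i g x).
  by apply: is_deriveD; exact/derivableP.
by split=> [x|]; [have [] := D x|apply/funext => x; have [] := D x].
Qed.

Lemma partial_cst a i :
  (forall x, derivable (fun _ : E => a) x (delta_mx 0 i)) /\
  partial i (fun _ : E => a) = (fun=> 0).
Proof.
by split=> [x|]; [exact: derivable_cst|apply/funext => x; exact: derive_cst].
Qed.

Lemma partial_aff f t w i : (forall x, derivable f x (delta_mx 0 i)) ->
  (forall x, derivable (f \o aff t w) x (delta_mx 0 i)) /\
  partial i (f \o aff t w) = (fun x => t * partial i f (aff t w x)).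
Proof.
move=> df.
have D x : is_derive x (delta_mx 0 i) (f \o aff t w) (t * partial i f (aff t w x)).
  by apply: is_derive_aff; exact/derivableP.
by split=> [x|]; [have [] := D x|apply/funext => x; have [] := D x].
Qed.

Lemma CkZ k a f : Ck k f -> Ck k (fun x => a * f x).
Proof.
elim: k f => [|k IH] f /= [cf Hf]; (split; first exact: rV_continuousZ) => // i.
have [df Cf] := Hf i; have [da pa] := partialZ a df.
by split=> //; rewrite pa; exact: IH.
Qed.

Lemma Ck_aff k t w f : Ck k f -> Ck k (f \o aff t w).
Proof.
elim: k f => [|k IH] f /= [cf Hf]; (split;
  first by move=> x; apply: continuous_comp; [exact: continuous_aff|exact: cf]) => // i.
have [df Cf] := Hf i; have [da pa] := partial_aff t w df.
split=> //; rewrite pa; exact: (CkZ t (IH _ Cf)).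
Qed.

Lemma Ck0_cst k : Ck k (fun _ : E => 0 : R).
Proof.
elim: k => [|k IH] /=; (split; first exact: cst_continuous) => // i.
by have [d ->] := partial_cst 0 i.
Qed.

Lemma Ck1M f g : Ck 1 f -> Ck 1 g -> Ck 1 (fun x => f x * g x).
Proof.
move=> [cf Hf] [cg Hg]; split; first exact: rV_continuousM.
move=> i; have [df [cpf _]] := Hf i; have [dg [cpg _]] := Hg i.
have [dM ->] := partialM df dg; split=> //; split=> //.
by apply: rV_continuousD; exact: rV_continuousM.
Qed.

(* The algebra generated by the functions [flat k (a x_i + c)]: it is stable
   under partial derivatives, which makes its elements smooth. *)
Inductive flat_alg : (E -> R) -> Prop :=
| FlatCst a : flat_alg (fun=> a)
| FlatGen k a c i : flat_alg (fun x => flat k (a * x 0 i + c))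
| FlatAdd f g of flat_alg f & flat_alg g : flat_alg (fun x => f x + g x)
| FlatMul f g of flat_alg f & flat_alg g : flat_alg (fun x => f x * g x).

Lemma flat_alg_continuous f : flat_alg f -> continuous f.
Proof.
elim=> {f} [a|k a c i|f g _ cf _ cg|f g _ cf _ cg].
- exact: cst_continuous.
- move=> x; apply: (@continuous_comp _ _ _ (fun x : E => a * x 0 i + c) (flat k)).
    apply: rV_continuousD; last exact: cst_continuous.
    by apply: rV_continuousZ; exact: coord_continuous.
  exact: continuous_flat.
- exact: rV_continuousD.
- exact: rV_continuousM.
Qed.

Lemma flat_alg_partial f i : flat_alg f ->
  (forall x, derivable f x (delta_mx 0 i)) /\ flat_alg (partial i f).
Proof.
elim=> {f} [a|k a c j|f g Af [df pf] Ag [dg pg]|f g Af [df pf] Ag [dg pg]].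
- by have [d ->] := partial_cst a i; split=> //; exact: FlatCst.
- have D x : is_derive x (delta_mx 0 i) (fun y : E => flat k (a * y 0 j + c))
      (a * (i == j)%:R * (flat k.+2 (a * x 0 j + c) +
        - k%:R * flat k.+1 (a * x 0 j + c))).
    rewrite mulNr -[(i == j)%:R](_ : (delta_mx 0 i : E) 0 j = _); last first.
      by rewrite mxE eqxx eq_sym.
    exact/is_derive_coord/is_derive_flat.
  split=> [x|]; first by have [] := D x.
  rewrite (_ : partial _ _ = fun x : E => a * (i == j)%:R *
    (flat k.+2 (a * x 0 j + c) + - k%:R * flat k.+1 (a * x 0 j + c))).
    apply: FlatMul; first exact: FlatCst.
    apply: FlatAdd; first exact: FlatGen.
    by apply: FlatMul; [exact: FlatCst|exact: FlatGen].
  by apply/funext => x; have [] := D x.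
- by have [d ->] := partialD df dg; split=> //; exact: FlatAdd.
- have [d ->] := partialM df dg; split=> //.
  by apply: FlatAdd; exact: FlatMul.
Qed.

Lemma flat_alg_smooth f : flat_alg f -> smooth f.
Proof.
move=> Af k; elim: k f Af => [|k IH] f Af /=; (split; first exact: flat_alg_continuous) => //.
by move=> i; have [d p] := flat_alg_partial i Af; split=> //; exact: IH.
Qed.

Lemma flat_alg_prod (I : Type) (s : seq I) (F : I -> E -> R) :
  (forall j, flat_alg (F j)) -> flat_alg (fun x => \prod_(j <- s) F j x).
Proof.
move=> AF; elim: s => [|j s IH].
  by under eq_fun do rewrite big_nil; exact: FlatCst.
by under eq_fun do rewrite big_cons; exact: FlatMul.
Qed.

End smooth_functions.

Section supports.
Context {R : realType} {n : nat}.
Local Notation E := 'rV[R]_n.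

Lemma notin_support (V : nmodType) (h : E -> V) x : ~ support_of h x -> h x = 0.
Proof.
by move=> hx; apply/eqP/negPn/negP => hx0; apply: hx; exact: subset_closure.
Qed.

Lemma support_sub (V : nmodType) (h : E -> V) (K : set E) : closed K ->
  (forall x, h x != 0 -> K x) -> support_of h `<=` K.
Proof.
by move=> cK hK; rewrite (closure_id K).1//; apply: closure_subset => x; exact: hK.
Qed.

Lemma closed_norm_le (r : R) : closed [set x : E | `|x| <= r].
Proof.
apply: (@preimage_closed _ _ (fun x : E => `|x|) [set y : R | y <= r]).
  by move=> x _; exact: norm_continuous.
exact: closed_le.
Qed.

Lemma compact_supportP (V : nmodType) (h : E -> V) :
  compact (support_of h) <->
  exists2 r : R, 0 < r & forall x, r < `|x| -> h x = 0.
Proof.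
split=> [/compact_bounded/bounded_rVP[r r0 hr]|[r r0 hr]].
  exists r => // x rx; apply: notin_support => /hr.
  by rewrite leNgt rx.
apply: bounded_closed_compact; last exact: closed_closure.
apply/bounded_rVP; exists r => // x.
have := @support_sub V h [set x | `|x| <= r].
apply.
  exact: closed_norm_le.
by move=> y /eqP hy; rewrite /= leNgt; apply/negP => /hr.
Qed.

Lemma support_partial (f : E -> R) i : support_of (partial i f) `<=` support_of f.
Proof.
apply: support_sub; first exact: closed_closure.
move=> x pfx; apply: contrapT => fx; move/eqP: pfx; apply.
rewrite /partial -(@near_eq_derive _ _ _ (cst 0)) ?derive_cst//.
have : open (~` support_of f) by apply: closed_openC; exact: closed_closure.
rewrite openE => /(_ _ fx); apply: filterS => y fy; apply/esym.
exact: notin_support.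
Qed.

Lemma continuous_compact_support_bounded (f : E -> R) : continuous f ->
  compact (support_of f) -> exists2 M : R, 0 < M & forall x, `|f x| <= M.
Proof.
move=> cf kf.
have /compact_bounded[M [_ fM]] : compact (f @` support_of f).
  by apply: continuous_compact => //; exact: continuous_subspaceT.
exists (`|M| + 1); first by rewrite ltr_wpDl.
move=> x; have [fx|/notin_support ->] := pselect (support_of f x).
  by apply: fM; [rewrite (le_lt_trans (ler_norm M))// ltrDl|exists x].
by rewrite normr0 addr_ge0.
Qed.

End supports.

(** * Integration by parts, by differentiating integrals of translates *)

Section compactly_supported_integrals.
Context {R : realType} {n : nat}.
Local Notation E := 'rV[R]_n.
Local Notation mu := (lebesgue_rV R n).
Implicit Types (x v w : E) (f g : E -> R) (D : set E).

Lemma aff1E w x : aff 1 w x = x + w.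
Proof. by rewrite /aff scale1r. Qed.

(** The dominating function for integrands of compact support. *)
Lemma ball_integrable (M r : R) D : measurable D ->
  mu.-integrable D (EFin \o (fun x => if `|x| <= r then M else 0)).
Proof.
move=> mD; apply: (@integrableS _ _ _ _ setT) => //.
have mB := measurable_norm_le (0 : E) r.
have mB' : measurable [set x : E | `|x| <= r].
  by rewrite (_ : mkset _ = [set x | `|x - 0| <= r])//;
    apply/seteqP; split=> x /=; rewrite subr0.
rewrite (_ : EFin \o _ = (cst M%:E) \_ [set x : E | `|x| <= r]); last first.
  by apply/funext => x; rewrite patchE /=; case: ifPn => [xr|/negP xr];
    [rewrite mem_set|rewrite memNset].
apply/(integrable_mkcond _ mB').1.
apply: (@bounded_integrable _ _ _ (fun=> M) `|M|) => //.
apply: bounded_set_lebesgue_lty => //.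
apply/bounded_rVP; exists (`|r| + 1); first by rewrite ltr_wpDl.
by move=> x /= /le_trans; apply; rewrite (le_trans (ler_norm r))// lerDl.
Qed.

Lemma Cc_integrable f D : continuous f -> compact (support_of f) ->
  measurable D -> mu.-integrable D (EFin \o f).
Proof.
move=> cf kf mD.
have [M M0 fM] := continuous_compact_support_bounded cf kf.
have [r r0 fr] := (compact_supportP f).1 kf.
apply: (le_integrable mD _ _ (ball_integrable M r mD)).
  by apply/measurable_EFinP; exact: continuous_measurable_rV.
move=> x Dx /=; rewrite lee_fin; case: (leP `|x| r) => xr.
  by rewrite (le_trans (fM x))// ler_norm.
by rewrite fr ?normr0.
Qed.

Lemma Rintegral_support (D : set E) f : (forall x, ~ D x -> f x = 0) ->
  \int[mu]_(x in D) f x = \int[mu]_x f x.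
Proof.
move=> fD; rewrite Rintegral_mkcond; congr Rintegral.
apply/funext => x; rewrite patchE; case: ifPn => // /negP xD.
by rewrite fD// => Dx; apply: xD; rewrite inE.
Qed.

(** Differentiation under the integral sign. For [D] the whole space it leads to integration by
    parts, for [D = Omega] to the shift inequality for the perimeter. *)
Lemma is_derive_integral_translate f (i : 'I_n) D (a : R) :
  Ck 1 f -> compact (support_of f) -> measurable D ->
  is_derive a 1 (fun s : R => \int[mu]_(x in D) f (x + s *: delta_mx 0 i))
    (\int[mu]_(x in D) partial i f (x + a *: delta_mx 0 i)).
Proof.
move=> [cf /(_ i)[df [cpf _]]] kf mD.
have kpf : compact (support_of (partial i f)).
  by apply: subclosed_compact kf (@support_partial _ _ f i); exact: closed_closure.
have [M M0 fM] := continuous_compact_support_bounded cpf kpf.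
have [r r0 fr] := (compact_supportP _).1 kpf.
pose F (s : R) x := f (x + s *: delta_mx 0 i).
have DF (s : R) x : is_derive s 1 (F ^~ x) (partial i f (x + s *: delta_mx 0 i)).
  by apply: is_derive_line; exact/derivableP.
have p1 s x : partial1of2 F s x = partial i f (x + s *: delta_mx 0 i).
  by rewrite partial1of2E; have [] := DF s x.
have au : `]a - 1, a + 1[%classic a by rewrite /= in_itv/=; apply/andP; lra.
have iF s : `]a - 1, a + 1[%classic s -> mu.-integrable D (EFin \o F s).
  move=> _; apply: (@integrableS _ _ _ _ setT) => //.
  have := @integrable_aff R n 1 (s *: delta_mx 0 i) setT f ltr01 measurableT
    (Cc_integrable cf kf measurableT).
  rewrite preimage_setT; congr (integrable _ _ _).
  by apply/funext => x /=; rewrite aff1E.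
(* For [|s - a| < 1], every translate of the ball of radius [r] that carries the derivative lies in
   this larger ball. *)
pose G x := if `|x| <= r + `|a| + 1 then M else 0.
have G0 x : 0 <= G x by rewrite /G; case: ifPn => // _; exact: ltW.
have GF s x : `]a - 1, a + 1[%classic s -> D x -> `|partial1of2 F s x| <= G x.
  rewrite /= in_itv/= => /andP[as1 as2] _; rewrite p1 /G.
  case: (leP `|x| (r + `|a| + 1)) => [_|xr]; first exact: fM.
  rewrite fr ?normr0//.
  have sa : `|s| < `|a| + 1.
    have : `|s - a| < 1 by rewrite ltr_norml; apply/andP; lra.
    by have := ler_normD (s - a) a; rewrite subrK; lra.
  have := ler_normB (x + s *: delta_mx 0 i) (s *: delta_mx 0 i).
  by rewrite addrK norm_scale_delta; lra.
have dF s x : `]a - 1, a + 1[%classic s -> D x -> derivable (F ^~ x) s 1.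
  by move=> _ _; have [] := DF s x.
have iG := ball_integrable M (r + `|a| + 1) mD.
have dd := derivable_under_integral mD au iF dF G0 iG GF.
have de := differentiation_under_integral mD au iF dF G0 iG GF.
split; first exact: dd.
rewrite -derive1E de; apply: eq_Rintegral => x _; exact: p1.
Qed.

(** By translation invariance the integral of [f (x + s e_i)] is constant in [s]; this is its
    derivative at 0. *)
Lemma integral_partial0 f (i : 'I_n) : Ck 1 f -> compact (support_of f) ->
  \int[mu]_x partial i f x = 0.
Proof.
move=> Cf kf; have [cf _] := Cf.
have H := is_derive_integral_translate i 0 Cf kf measurableT.
have E1 : (fun s : R => \int[mu]_x f (x + s *: delta_mx 0 i)) =
    cst (\int[mu]_x f x).
  apply/funext => s /=.
  rewrite (@Rintegral_aff R n 1 (s *: delta_mx 0 i) setT f)//; last first.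
    exact: Cc_integrable.
  rewrite expr1n mul1r preimage_setT; apply: eq_Rintegral => x _.
  by rewrite aff1E.
rewrite E1 in H; case: H => _; rewrite derive_cst => H.
by rewrite H; apply: eq_Rintegral => x _; rewrite scale0r addr0.
Qed.

Lemma integral_by_parts f g (i : 'I_n) : Ck 1 f -> Ck 1 g ->
  compact (support_of f) ->
  \int[mu]_x (f x * partial i g x) = - \int[mu]_x (partial i f x * g x).
Proof.
move=> Cf Cg kf; have [cf /(_ i)[df [cpf _]]] := Cf.
have [cg /(_ i)[dg [cpg _]]] := Cg.
have [r r0 fr] := (compact_supportP _).1 kf.
have kM h : compact (support_of (fun x => f x * h x)).
  by apply/compact_supportP; exists r => // x xr; rewrite fr// mul0r.
have kP : compact (support_of (fun x => partial i f x * g x)).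
  have kpf : compact (support_of (partial i f)).
    by apply: subclosed_compact kf (@support_partial _ _ f i); exact: closed_closure.
  have [s s0 fs] := (compact_supportP _).1 kpf.
  by apply/compact_supportP; exists s => // x xr; rewrite fs// mul0r.
have := integral_partial0 i (Ck1M Cf Cg) (kM g).
rewrite (partialM df dg).2 RintegralD//; last 2 first.
- by apply: Cc_integrable => //; exact: rV_continuousM.
- by apply: Cc_integrable => //; exact: rV_continuousM.
by move/eqP; rewrite addr_eq0 => /eqP.
Qed.

End compactly_supported_integrals.

(** * Test functions increasing the covered part of an open set to all of it *)

Section exhaustion.
Context {R : realType} {n : nat}.
Local Notation E := 'rV[R]_n.
Local Notation mu := (lebesgue_rV R n).
Implicit Types (x : E).

(** Positive exactly on the open cube of centre [c] and radius [r]. The factors are spelled as in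
    [FlatGen]. The guard matters in dimension 0, where the empty product would give 1 on a discarded
    cube. *)
Definition bump (c : E) (r : R) x : R :=
  if 0 < r then
    \prod_i (flat 0 (1 * x 0 i + (r - c 0 i)) * flat 0 (-1 * x 0 i + (r + c 0 i)))
  else 0.

Lemma bump_alg c r : flat_alg (bump c r).
Proof.
rewrite /bump; case: (0 < r); last exact: FlatCst.
by apply: flat_alg_prod => i; apply: FlatMul; exact: FlatGen.
Qed.

Lemma bump01 c r x : 0 <= bump c r x <= 1.
Proof.
rewrite /bump; case: ifPn => _; last by rewrite lexx ler01.
apply/andP; split; first by apply: prodr_ge0 => i _; rewrite mulr_ge0 ?flat_ge0.
by apply: prodr_ile1 => i _; rewrite mulr_ge0 ?flat_ge0//= mulr_ile1 ?flat_ge0 ?flat0_le1.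
Qed.

Lemma bump_gt0 c r x : `|x - c| < r -> 0 < bump c r x.
Proof.
move=> xr; rewrite /bump (le_lt_trans (normr_ge0 _) xr).
apply: prodr_gt0 => i _; have := le_lt_trans (ler_coord_norm _ i) xr.
rewrite !mxE ltr_norml => /andP[? ?].
by rewrite mulr_gt0 ?flat0_gt0//; lra.
Qed.

Lemma bump_neq0 c r x : bump c r x != 0 -> 0 < r /\ `|x - c| < r.
Proof.
rewrite /bump; case: ifPn => [r0 xr|]; last by rewrite eqxx.
split=> //; apply: rV_norm_lt => // i; rewrite !mxE ltNge.
apply: contra xr => xr; rewrite (bigD1 i)//= !mulf_eq0 -orbA.
move: xr; rewrite ler_normr => /orP[xr|xr]; apply/or3P.
  by apply: Or32; rewrite flat_le0//; lra.
by apply: Or31; rewrite flat_le0//; lra.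
Qed.

(** One minus the product over [j < N] of [(1 - bump_j) ^ N]. It vanishes outside the first [N]
    cubes; where the bump of index [k < N] has the value [b > 0] it is at least [1 - (1 - b) ^ N],
    which tends to 1. The power is a constant product so that [flat_alg_prod] applies. *)
Definition cutoff (c : nat -> E) (r : nat -> R) N x : R :=
  1 + -1 * \prod_(j < N) \prod_(k < N) (1 + -1 * bump (c j) (r j) x).

Lemma cutoff_alg c r N : flat_alg (cutoff c r N).
Proof.
apply: FlatAdd; first exact: FlatCst.
apply: FlatMul; first exact: FlatCst.
apply: flat_alg_prod => j; apply: flat_alg_prod => k.
apply: FlatAdd; first exact: FlatCst.
by apply: FlatMul; [exact: FlatCst|exact: bump_alg].
Qed.

Let bumpC01 c r x : 0 <= 1 + -1 * bump c r x <= 1.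
Proof. by have := bump01 c r x; lra. Qed.

Let prod01 (c : nat -> E) (r : nat -> R) N x (j : 'I_N) :
  0 <= \prod_(k < N) (1 + -1 * bump (c j) (r j) x) <= 1.
Proof.
apply/andP; split; first by apply: prodr_ge0 => k _; case/andP: (bumpC01 (c j) (r j) x).
by apply: prodr_ile1 => k _; exact: bumpC01.
Qed.

Lemma cutoff01 c r N x : 0 <= cutoff c r N x <= 1.
Proof.
have : 0 <= \prod_(j < N) \prod_(k < N) (1 + -1 * bump (c j) (r j) x) <= 1.
  apply/andP; split; first by apply: prodr_ge0 => j _; case/andP: (prod01 c r x j).
  by apply: prodr_ile1 => j _; exact: prod01.
by rewrite /cutoff; lra.
Qed.

Lemma cutoff_neq0 c r N x : cutoff c r N x != 0 ->
  exists j : 'I_N, 0 < r j /\ `|x - c j| < r j.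
Proof.
move=> x0; apply: contrapT => /forallNP H; move/eqP: x0; apply.
rewrite /cutoff big1 ?mulr1 ?subrr; first by ring.
move=> j _; rewrite big1// => k _.
have -> : bump (c j) (r j) x = 0; last by ring.
by apply/eqP/negPn/negP => /bump_neq0 /H.
Qed.

Lemma cutoff_cvg1 c r x k : `|x - c k| < r k ->
  (fun N => cutoff c r N x) @ \oo --> (1 : R).
Proof.
move=> xk; have b0 := bump_gt0 xk; have b1 := bump01 (c k) (r k) x.
set b := bump _ _ _ in b0 b1.
apply/cvgrPdist_le => e e0.
have /cvgr0Pnorm_le : (GRing.exp (1 - b) : R ^nat) x @[x --> \oo] --> 0.
  by apply: cvg_expr; rewrite ltr_norml; apply/andP; lra.
move=> /(_ _ e0) H; near=> N.
have kN : (k < N)%N by near: N; exact: nbhs_infty_gt.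
have : `|(1 - b) ^+ N| <= e by near: N.
apply: le_trans; rewrite /cutoff (bigD1 (Ordinal kN))//= prodr_const card_ord -/b.
set p := \prod_(_ < _ | _) _.
have p01 : 0 <= p <= 1.
  apply/andP; split; first by apply: prodr_ge0 => j _; case/andP: (prod01 c r x j).
  by apply: prodr_ile1 => j _; exact: prod01.
have q0 : 0 <= (1 - b) ^+ N by rewrite exprn_ge0//; lra.
rewrite (_ : 1 + -1 * b = 1 - b); last by ring.
rewrite (_ : 1 - _ = (1 - b) ^+ N * p); last by ring.
rewrite normrM ler_piMr// ger0_norm; by case/andP: p01.
Unshelve. all: by end_near. Qed.

Lemma test_function_exhaustion (U : set E) : open U -> bounded_set U ->
  exists chi : nat -> E -> R, [/\ forall N, test_function U (chi N),
    forall N x, 0 <= chi N x <= 1 &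
    forall x, U x -> (fun N => chi N x) @ \oo --> (1 : R)].
Proof.
move=> oU /bounded_rVP[s s0 Us].
have [c [r [crU Ucr]]] := open_cube_cover oU.
exists (cutoff c r); split=> [N|N x|x /Ucr[k]]; [|exact: cutoff01|exact: cutoff_cvg1].
(* A discarded cube has radius 0 and is a single point, possibly outside [U]; hence the restriction
   to [0 < r j]. *)
pose K := \bigcup_(j in [set j : 'I_N | 0 < r j]) [set x | `|x - c j| <= r j].
have cK : closed K.
  apply: closed_bigcup; first exact: finite_finset.
  move=> j _; apply: (@preimage_closed _ _ (fun x : E => x - c j) [set x | `|x| <= r j]).
    move=> x _; rewrite (_ : (fun _ => _) = aff 1 (- c j)); first exact: continuous_aff.
    by apply/funext => y; rewrite aff1E.
  exact: closed_norm_le.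
have nK x : cutoff c r N x != 0 -> K x.
  by move=> /cutoff_neq0[j [r0 xj]]; exists j => //=; exact: ltW.
have KU : K `<=` U by move=> x [j /= r0 xj]; exact: crU r0 xj.
split.
- exact/flat_alg_smooth/cutoff_alg.
- apply/compact_supportP; exists s => // x sx; apply/eqP/negPn/negP => /nK/KU/Us.
  by rewrite leNgt sx.
- exact: subset_trans (support_sub cK nK) KU.
Qed.

Lemma integral_exhaustion (U : set E) (chi : nat -> E -> R) :
  open U -> bounded_set U ->
  (forall N, test_function U (chi N)) ->
  (forall N x, 0 <= chi N x <= 1) ->
  (forall x, U x -> (fun N => chi N x) @ \oo --> (1 : R)) ->
  (fun N => (\int[mu]_(x in U) (chi N x)%:E)%E) @ \oo --> mu U.
Proof.
move=> oU bU tchi chi01 chi1.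
have mU := open_measurable_rV oU.
have -> : mu U = (\int[mu]_(x in U) (cst 1%:E) x)%E.
  by rewrite integral_cst// mul1e.
apply: (@dominated_cvg _ _ _ mu U mU (fun N x => (chi N x)%:E) (cst 1%:E) (cst 1%:E)) => //.
- move=> N; have [/(_ 0%N)[cN _] _ _] := tchi N.
  by apply/measurable_EFinP; exact: continuous_measurable_rV.
- by move=> x Ux; apply: cvg_EFin; [exact: nearW|exact: chi1].
- apply: (@bounded_integrable _ _ _ (fun=> 1) 1) => //.
    exact: bounded_set_lebesgue_lty.
  by move=> x _; rewrite normr1.
- by move=> N x _; rewrite /= lee_fin ger0_norm; case/andP: (chi01 N x).
Qed.

End exhaustion.

Section real_integrals.
Context {R : realType} {d : measure_display} {T : measurableType d}.
Context (mu : {measure set T -> \bar R}) (D : set T) (mD : measurable D).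
Implicit Types f g : T -> R.
Local Notation integrable f := (mu.-integrable D (EFin \o f)).

Lemma integrable_addr f g : integrable f -> integrable g ->
  integrable (fun x => f x + g x).
Proof. by move=> fi gi; exact: (integrableD mD fi gi). Qed.

Lemma integrable_mulr (a : R) f : integrable f ->
  integrable (fun x => a * f x).
Proof. by move=> fi; exact: (integrableZl mD a fi). Qed.

Lemma integrable_subr f g : integrable f -> integrable g ->
  integrable (fun x => f x - g x).
Proof. by move=> fi gi; exact: (integrableB mD fi gi). Qed.

Lemma Rintegral_eq0 f : (forall x, D x -> f x = 0) ->
  \int[mu]_(x in D) f x = 0.
Proof.
move=> f0; rewrite /Rintegral integral0_eq// => x Dx.
by rewrite f0.
Qed.

Lemma integrable_sumr (I : Type) (s : seq I) (F : I -> T -> R) :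
  (forall i, integrable (F i)) -> integrable (fun x => \sum_(i <- s) F i x).
Proof.
move=> Fi; elim: s => [|i s IH].
  rewrite (_ : EFin \o _ = cst 0%E); first exact: integrable0.
  by apply/funext => x /=; rewrite big_nil.
rewrite (_ : (fun x => _) = (fun x => F i x + \sum_(j <- s) F j x)).
  exact: integrable_addr.
by apply/funext => x; rewrite big_cons.
Qed.

Lemma Rintegral_sumr (I : Type) (s : seq I) (F : I -> T -> R) :
  (forall i, integrable (F i)) ->
  \int[mu]_(x in D) (\sum_(i <- s) F i x) = \sum_(i <- s) \int[mu]_(x in D) F i x.
Proof.
move=> Fi; elim: s => [|i s IH].
  by rewrite big_nil Rintegral_eq0// => x _; rewrite big_nil.
rewrite big_cons -IH -RintegralD//; last exact: integrable_sumr.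
by apply: eq_Rintegral => x _; rewrite big_cons.
Qed.

End real_integrals.

(** * Perimeter *)

Section perimeter_bounds.
Context {R : realType} {n : nat}.
Local Notation E := 'rV[R]_n.
Local Notation mu := (lebesgue_rV R n).
Implicit Types (x v w : E) (f : E -> R) (psi : E -> E) (Omega : set E).

Definition admissible psi : Prop :=
  [/\ forall i, Ck 1 (fun x => psi x 0 i), compact (support_of psi) &
      forall x, \sum_i psi x 0 i ^+ 2 <= 1].

Lemma perimeter_ubound Omega psi : admissible psi ->
  ((\int[mu]_(x in Omega) divergence psi x)%:E <= perimeter Omega)%E.
Proof.
by move=> [Cpsi kpsi npsi]; apply: ereal_sup_ubound; exists psi.
Qed.

Lemma perimeter_le Omega (p : \bar R) :
  (forall psi, admissible psi ->
    ((\int[mu]_(x in Omega) divergence psi x)%:E <= p)%E) ->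
  (perimeter Omega <= p)%E.
Proof.
move=> H; apply: ge_ereal_sup => _ [psi [Cpsi kpsi npsi ->]].
by apply: H; split.
Qed.

Lemma rV_continuous_sum (I : Type) (s : seq I) (F : I -> E -> R) :
  (forall i, continuous (F i)) -> continuous (fun x => \sum_(i <- s) F i x).
Proof.
move=> cF; elim: s => [|i s IH].
  rewrite (_ : (fun x => _) = cst 0); first exact: cst_continuous.
  by apply/funext => x; rewrite big_nil.
rewrite (_ : (fun x => _) = (fun x => F i x + \sum_(j <- s) F j x)).
  exact: rV_continuousD.
by apply/funext => x; rewrite big_cons.
Qed.

Lemma continuous_divergence psi : admissible psi -> continuous (divergence psi).
Proof.
by move=> [Cpsi _ _]; apply: rV_continuous_sum => i; have [_ /(_ i)[_ []]] := Cpsi i.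
Qed.

Lemma compact_support_divergence psi : admissible psi ->
  compact (support_of (divergence psi)).
Proof.
move=> [_ /compact_supportP[r r0 psi0] _].
apply/compact_supportP; exists r => // x rx.
rewrite /divergence big1// => i _; apply: notin_support.
have K0 : support_of (fun y => psi y 0 i) `<=` [set y | `|y| <= r].
  apply: support_sub; first exact: closed_norm_le.
  by move=> y; apply: contraNP => /negP; rewrite -ltNge => /psi0 ->; rewrite mxE.
by move=> /support_partial /K0; rewrite /= leNgt rx.
Qed.

Definition coordinate_field f (i : 'I_n) : E -> E := fun x => f x *: delta_mx 0 i.

Lemma coordinate_field_coord f i j :
  (fun x => coordinate_field f i x 0 j) = if j == i then f else fun=> 0.
Proof.
apply/funext => x; rewrite !mxE eqxx/=; case: eqP => _; by rewrite ?mulr1 ?mulr0.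
Qed.

Lemma divergence_coordinate_field f i :
  divergence (coordinate_field f i) = partial i f.
Proof.
apply/funext => x; rewrite /divergence (bigD1 i)//= coordinate_field_coord eqxx.
rewrite big1 ?addr0// => j ji; rewrite coordinate_field_coord (negbTE ji).
by rewrite (partial_cst 0 j).2.
Qed.

Lemma admissible_coordinate_field f i : Ck 1 f -> compact (support_of f) ->
  (forall x, `|f x| <= 1) -> admissible (coordinate_field f i).
Proof.
move=> Cf /compact_supportP[r r0 fr] f1; split=> [j||x].
- by rewrite coordinate_field_coord; case: eqP => // _; exact: Ck0_cst.
- by apply/compact_supportP; exists r => // x /fr fx; rewrite /coordinate_field fx scale0r.
- rewrite (bigD1 i)//= big1; last first.
    by move=> j ji; rewrite !mxE (negbTE ji) mulr0 expr0n.
  by rewrite !mxE !eqxx mulr1 addr0 -real_normK ?num_real// expr_le1.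
Qed.

Lemma perimeter_ge0 Omega : (0 <= perimeter Omega)%E.
Proof.
pose psi : E -> E := fun=> 0.
have cE i : (fun x => psi x 0 i) = (fun=> 0) by apply/funext => x; rewrite mxE.
have Apsi : admissible psi.
  split=> [i||x]; first by rewrite cE; exact: Ck0_cst.
    by apply/compact_supportP; exists 1.
  by rewrite big1// => i _; rewrite mxE expr0n.
have := perimeter_ubound Omega Apsi.
rewrite (_ : divergence psi = fun=> 0).
  by rewrite Rintegral_eq0.
apply/funext => x; rewrite /divergence big1// => i _.
by rewrite cE (partial_cst 0 i).2.
Qed.

Lemma test_shift_le_perimeter Omega (chi : E -> R) (i : 'I_n) (t : R) :
  measurable Omega -> 0 < t ->
  (forall x, Omega x -> ~ Omega (x + t *: delta_mx 0 i)) ->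
  test_function Omega chi -> (forall x, `|chi x| <= 1) ->
  ((\int[mu]_(x in Omega) chi x)%:E <= t%:E * perimeter Omega)%E.
Proof.
move=> mO t0 Ot [schi kchi chiO] chi1.
have Cchi := schi 1%N.
have := perimeter_ge0 Omega.
have := @perimeter_ubound Omega.
case: (perimeter Omega) => [p||]//; last first.
  by move=> _ _; rewrite gt0_muley ?leey ?lte_fin.
move=> HP p0; rewrite -EFinM lee_fin.
pose F (s : R) := \int[mu]_(x in Omega) chi (x + s *: delta_mx 0 i).
pose F' (s : R) := \int[mu]_(x in Omega) partial i chi (x + s *: delta_mx 0 i).
have DF (s : R) : is_derive s 1 F (F' s).
  exact: is_derive_integral_translate.
(* The field [- chi (x + s e_i) e_i] is admissible, and the integral of its divergence over [Omega]
   is [- F' s]. *)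
have F'p (s : R) : - p <= F' s.
  pose w : E := s *: delta_mx 0 i.
  pose f := fun x => -1 * (chi \o aff 1 w) x.
  have [d1 p1] := @partial_aff R n chi 1 w i (fun x => (Cchi.2 i).1 x).
  have [d2 p2] := partialZ (-1) d1.
  have Cf : Ck 1 f by apply: CkZ; exact: Ck_aff.
  have kf : compact (support_of f).
    have [r r0 chir] := (compact_supportP _).1 kchi.
    apply/compact_supportP; exists (r + `|w|); first by rewrite ltr_pwDl.
    move=> x xr; rewrite /f/= chir ?mulr0// aff1E.
    by have := ler_normB (x + w) w; rewrite addrK; lra.
  have f1 x : `|f x| <= 1 by rewrite /f mulN1r normrN; exact: chi1.
  have := HP _ (admissible_coordinate_field i Cf kf f1).
  rewrite divergence_coordinate_field p2 p1 lee_fin.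
  rewrite RintegralZl//; last first.
    apply: (@integrableS _ _ _ _ setT) => //.
    have kp : compact (support_of (partial i chi)).
      by apply: subclosed_compact kchi (@support_partial _ _ chi i); exact: closed_closure.
    have := @integrable_aff R n 1 w setT _ ltr01 measurableT
      (Cc_integrable (Cchi.2 i).2.1 kp measurableT).
    rewrite preimage_setT; congr (integrable _ _ _).
    by apply/funext => x /=; rewrite mul1r.
  rewrite mulN1r lerNl; congr (_ <= _); apply: eq_Rintegral => x _.
  by rewrite mul1r aff1E.
have cF : {within `[0, t], continuous F}.
  apply: continuous_subspaceT => s.
  by apply: differentiable_continuous; apply/derivable1_diffP; have [] := DF s.
have [c _ Fc] := MVT_segment (ltW t0) (fun s _ => DF s) cF.
have F0 : F 0 = \int[mu]_(x in Omega) chi x.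
  by apply: eq_Rintegral => x _; rewrite scale0r addr0.
have Ft : F t = 0.
  by apply: Rintegral_eq0 => x Ox; apply: notin_support => /chiO; exact: Ot.
move: Fc; rewrite F0 Ft sub0r subr0 => Fc.
by rewrite -lerN2 Fc [t * _]mulrC -mulNr ler_pM2r.
Qed.

Lemma perimeter_shift Omega (i : 'I_n) (t : R) : open Omega ->
  bounded_set Omega -> 0 < t ->
  (forall x, Omega x -> ~ Omega (x + t *: delta_mx 0 i)) ->
  (mu Omega <= t%:E * perimeter Omega)%E.
Proof.
move=> oO bO t0 Ot; have mO := open_measurable_rV oO.
have [chi [tchi chi01 chi1]] := test_function_exhaustion oO bO.
apply: (cvge_to_le (integral_exhaustion oO bO tchi chi01 chi1)).
apply: nearW => N.
have [/(_ 0%N)[cN _] kN _] := tchi N.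
have iN := Cc_integrable cN kN mO.
have -> : (\int[mu]_(x in Omega) (chi N x)%:E)%E = (\int[mu]_(x in Omega) chi N x)%:E.
  by rewrite fineK//; exact: integrable_fin_num.
apply: (@test_shift_le_perimeter _ _ i) => // x.
by rewrite ger0_norm; case/andP: (chi01 N x).
Qed.

(** A field is composed with the inverse homothety, which preserves its pointwise bound. The change
    of variables contributes [t ^+ n] and the divergence [t^-1]. *)
Lemma perimeter_aff (t : R) v Omega : 0 < t -> measurable Omega ->
  ((t ^+ n / t)%:E * perimeter (aff t v @^-1` Omega) <= perimeter Omega)%E.
Proof.
move=> t0 mO; have tn0 : 0 < t ^+ n / t by rewrite divr_gt0 ?exprn_gt0.
rewrite -lee_pdivlMl//; apply: perimeter_le => psi Apsi.
rewrite lee_pdivlMl//.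
have [Cpsi kpsi npsi] := Apsi.
have tN0 : t != 0 by rewrite gt_eqF.
pose w : E := - (t^-1 *: v).
pose phi : E -> E := psi \o aff t^-1 w.
have pE i : (fun x => phi x 0 i) = (fun y => psi y 0 i) \o aff t^-1 w by [].
have divE : divergence phi = fun x => t^-1 * divergence psi (aff t^-1 w x).
  apply/funext => x; rewrite /divergence mulr_sumr; apply: eq_bigr => i _.
  by rewrite pE (partial_aff _ _ (fun y => ((Cpsi i).2 i).1 y)).2.
have Aphi : admissible phi.
  split=> [i||x]; first by rewrite pE; exact: Ck_aff.
    have [r r0 psir] := (compact_supportP _).1 kpsi.
    apply/compact_supportP; exists (t * r + `|v|) => [|x xr].
      by rewrite ltr_pwDl// mulr_gt0.
    rewrite /phi/= psir//.
    have := ler_normD (t *: aff t^-1 w x) v.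
    rewrite -/(aff t v _) affKV// normrZ gtr0_norm// => H.
    by rewrite -(ltr_pM2l t0); lra.
  exact: npsi.
have cphi := continuous_divergence Aphi.
have kphi := compact_support_divergence Aphi.
have E1 := Rintegral_aff v t0 mO (Cc_integrable cphi kphi mO).
have mP := measurable_aff_preimage t v mO.
have E2 : \int[mu]_(x in aff t v @^-1` Omega) divergence phi (aff t v x) =
    t^-1 * \int[mu]_(x in aff t v @^-1` Omega) divergence psi x.
  rewrite -RintegralZl//; last first.
    apply: Cc_integrable => //; first exact: continuous_divergence.
    exact: compact_support_divergence.
  by apply: eq_Rintegral => x _; rewrite divE affK.
rewrite E2 mulrA in E1.
by have := perimeter_ubound Omega Aphi; rewrite E1.
Qed.

(** Each integral differs from the one over [I] by at most [M] times the volume of [O] minus [I];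
    the two errors give the factor 2. *)
Lemma Rintegral_between f (M : R) (I A B O : set E) :
  continuous f -> compact (support_of f) -> (forall x, `|f x| <= M) ->
  measurable I -> measurable A -> measurable B -> measurable O ->
  (mu O < +oo)%E -> I `<=` A -> I `<=` B -> A `<=` O -> B `<=` O ->
  `|\int[mu]_(x in A) f x - \int[mu]_(x in B) f x| <=
    2 * M * (fine (mu O) - fine (mu I)).
Proof.
move=> cf kf fM mI mA mB mO Ooo IA IB AO BO.
have mOI : measurable (O `\` I) by exact: measurableD.
have fin (C : set E) : measurable C -> C `<=` O -> mu C \is a fin_num.
  move=> mC CO; rewrite ge0_fin_numE//; apply: le_lt_trans Ooo.
  by apply: le_measure; rewrite ?inE.
have muOI : fine (mu (O `\` I)) = fine (mu O) - fine (mu I).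
  rewrite measureD//= (setIidr (subset_trans IA AO)) fineB//; apply: fin => //.
  exact: subset_trans IA AO.
have H (C : set E) : measurable C -> I `<=` C -> C `<=` O ->
    `|\int[mu]_(x in C) f x - \int[mu]_(x in I) f x| <= M * (fine (mu O) - fine (mu I)).
  move=> mC IC CO; have mCI : measurable (C `\` I) by exact: measurableD.
  have -> : \int[mu]_(x in C) f x =
      \int[mu]_(x in I) f x + \int[mu]_(x in C `\` I) f x.
    rewrite -[in LHS](setDUK IC) Rintegral_setU//.
      by apply: Cc_integrable => //; exact: measurableU.
    by apply/disj_setPS => x [Ix [_ nIx]].
  rewrite addrAC subrr add0r.
  apply: le_trans (le_normr_Rintegral mCI (Cc_integrable cf kf mCI)) _.
  have fi : mu.-integrable (C `\` I) (EFin \o (fun x => `|f x|)).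
    have := Cc_integrable cf kf mCI.
    by move/integrable_abse.
  have CIoo : (mu (C `\` I) < +oo)%E.
    apply: le_lt_trans Ooo; apply: le_measure; rewrite ?inE//.
    by move=> x [Cx _]; exact: CO.
  apply: (@le_trans _ _ (\int[mu]_(x in C `\` I) M)).
    apply: le_Rintegral => //.
    by apply: (@bounded_integrable _ _ _ (fun=> M) `|M|).
  rewrite Rintegral_cst// -muOI.
  have M0 : 0 <= M by exact: le_trans (fM 0).
  rewrite ler_wpM2l// fine_le//.
  - by rewrite ge0_fin_numE.
  - by apply: fin => // x [].
  - by apply: le_measure; rewrite ?inE//; exact: setSD.
have := H _ mA IA AO; have := H _ mB IB BO.
by rewrite !ler_norml => /andP[? ?] /andP[? ?]; apply/andP; lra.
Qed.

End perimeter_bounds.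

Lemma cvg_sum_real {R : realType} (I : Type) (s : seq I) (u : I -> nat -> R)
    (l : I -> R) : (forall i, u i @ \oo --> l i) ->
  (fun k => \sum_(i <- s) u i k) @ \oo --> \sum_(i <- s) l i.
Proof.
move=> ul; elim: s => [|i s IH].
  by under eq_fun do rewrite big_nil; rewrite big_nil; exact: cvg_cst.
by under eq_fun do rewrite big_cons; rewrite big_cons; exact: cvgD.
Qed.

(** * Torsional rigidity and first eigenvalue *)

Section square_integrable_functions.
Context {R : realType} {n : nat}.
Local Notation E := 'rV[R]_n.
Local Notation mu := (lebesgue_rV R n).
Context (Omega : set E) (mO : measurable Omega).
Implicit Types (u f g : E -> R).
Local Notation integrable f := (mu.-integrable Omega (EFin \o f)).
Local Notation I f := (\int[mu]_(x in Omega) f x).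

Lemma square_integrableB f g : square_integrable Omega f ->
  square_integrable Omega g -> square_integrable Omega (fun x => f x - g x).
Proof.
move=> [mf fi] [mg gi]; have mfg := measurable_funB mf mg; split; first exact: mfg.
apply: (@le_integrable _ _ _ mu Omega mO _
  (EFin \o (fun x => 2 * f x ^+ 2 + 2 * g x ^+ 2))).
- by apply/measurable_EFinP; exact: measurable_funX.
- move=> x Ox; rewrite /= lee_fin [leLHS]ger0_norm ?sqr_ge0//.
  rewrite [leRHS]ger0_norm; last first.
    by apply: addr_ge0; apply: mulr_ge0 => //; exact: sqr_ge0.
  by have := sqr_ge0 (f x + g x); rewrite !expr2; lra.
- by apply: integrable_addr => //; apply: integrable_mulr.
Qed.

Lemma square_integrable_integrable f : (mu Omega < +oo)%E ->
  square_integrable Omega f -> integrable f.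
Proof.
move=> Ooo [mf fi].
apply: (@le_integrable _ _ _ mu Omega mO _ (EFin \o (fun x => 1 + f x ^+ 2))).
- exact/measurable_EFinP.
- move=> x Ox; rewrite /= lee_fin [leRHS]ger0_norm ?addr_ge0 ?sqr_ge0//.
  rewrite -(real_normK (num_real (f x))); have := sqr_ge0 (1 - `|f x|).
  by have := normr_ge0 (f x); move: `|f x| => a; rewrite !expr2; lra.
- apply: integrable_addr => //.
  by apply: (@bounded_integrable _ _ _ (fun=> 1) 1) => // x _; rewrite normr1.
Qed.

(** A weighted inequality in place of Minkowski's: pointwise [|f^2 - f_k^2| <= d f^2 + (1 + 1 / d)
    (f_k - f)^2], where the first integral is small by the choice of [d] and the second for large
    [k]. *)
Lemma cvg_integral_square (f_ : nat -> E -> R) f :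
  (forall k, square_integrable Omega (f_ k)) -> square_integrable Omega f ->
  (fun k => I (fun x => (f_ k x - f x) ^+ 2)) @ \oo --> (0 : R) ->
  (fun k => I (fun x => f_ k x ^+ 2)) @ \oo --> I (fun x => f x ^+ 2).
Proof.
move=> sf_ sf /cvgr0Pnorm_le H; apply/cvgrPdist_le => e e0.
pose B := I (fun x => f x ^+ 2).
have B0 : 0 <= B by apply: Rintegral_ge0 => x _; exact: sqr_ge0.
(* Ensures [d * B <= e / 2]; the [+ 1] covers [B = 0]. *)
pose d := e / (2 * (B + 1)).
have d0 : 0 < d by rewrite divr_gt0// mulr_gt0// ltr_wpDl.
have C0 : 0 < 1 + d^-1 by rewrite addr_gt0// invr_gt0.
have e'0 : 0 < e / (2 * (1 + d^-1)) by rewrite divr_gt0// mulr_gt0.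
apply: filterS (H _ e'0) => k; set A := (X in `|X| <= _) => Ak.
have [mk ik] := sf_ k; have [mf fi] := sf.
have [mkf ikf] := square_integrableB (sf_ k) sf.
have A0 : 0 <= A by apply: Rintegral_ge0 => x _; exact: sqr_ge0.
rewrite ger0_norm// in Ak.
rewrite -RintegralB//.
have iD : integrable (fun x => f x ^+ 2 - f_ k x ^+ 2) by exact: integrable_subr.
apply: le_trans (le_normr_Rintegral mO iD) _.
have iR : integrable (fun x => d * f x ^+ 2 + (1 + d^-1) * (f_ k x - f x) ^+ 2).
  by apply: integrable_addr => //; exact: integrable_mulr.
apply: (@le_trans _ _ (I (fun x => d * f x ^+ 2 + (1 + d^-1) * (f_ k x - f x) ^+ 2))).
  apply: le_Rintegral => //; first by move/integrable_abse : iD.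
  move=> x _; set a := f_ k x; set b := f x.
  (* AM-GM: [2 b (a - b) <= d b^2 + (a - b)^2 / d] *)
  have amgm : `|2 * (b * (a - b))| <= d * b ^+ 2 + d^-1 * (a - b) ^+ 2.
    have dd : d * d^-1 = 1 by rewrite divff// gt_eqF.
    have : 0 <= d * (b - d^-1 * (a - b)) ^+ 2 by rewrite mulr_ge0 ?sqr_ge0// ltW.
    have : 0 <= d * (b + d^-1 * (a - b)) ^+ 2 by rewrite mulr_ge0 ?sqr_ge0// ltW.
    rewrite (_ : d * (b + _) ^+ 2 = d * b ^+ 2 + 2 * (d * d^-1) * (b * (a - b)) +
      (d * d^-1) * d^-1 * (a - b) ^+ 2); last by ring.
    rewrite (_ : d * (b - _) ^+ 2 = d * b ^+ 2 - 2 * (d * d^-1) * (b * (a - b)) +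
      (d * d^-1) * d^-1 * (a - b) ^+ 2); last by ring.
    by rewrite dd ler_norml => ? ?; apply/andP; lra.
  rewrite (_ : b ^+ 2 - a ^+ 2 = - (2 * (b * (a - b))) - (a - b) ^+ 2); last by ring.
  apply: le_trans (ler_normB _ _) _; rewrite normrN.
  rewrite [X in _ + X]ger0_norm ?sqr_ge0//; lra.
rewrite RintegralD//; last 2 first.
- exact: integrable_mulr.
- exact: integrable_mulr.
rewrite !RintegralZl// -/B -/A.
have : d * B <= e / 2.
  have -> : e / 2 = d * (B + 1).
    by rewrite /d invfM mulrA mulfVK// gt_eqF// ltr_wpDl.
  by rewrite ler_pM2l// lerDl.
have : (1 + d^-1) * A <= e / 2.
  rewrite -(ler_pM2l C0) in Ak; apply: (le_trans Ak).
  move: C0; set C := 1 + _ => C0.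
  by rewrite (_ : C * (e / (2 * C)) = e / 2)//; field; rewrite gt_eqF.
lra.
Qed.

(** Pointwise [|f - f_k| <= d + (f_k - f)^2 / d], and the constant [d] has a small integral since
    the measure is finite. *)
Lemma cvg_integral_L2 (f_ : nat -> E -> R) f : (mu Omega < +oo)%E ->
  (forall k, square_integrable Omega (f_ k)) -> square_integrable Omega f ->
  (fun k => I (fun x => (f_ k x - f x) ^+ 2)) @ \oo --> (0 : R) ->
  (fun k => I (fun x => f_ k x)) @ \oo --> I (fun x => f x).
Proof.
move=> Ooo sf_ sf /cvgr0Pnorm_le H; apply/cvgrPdist_le => e e0.
pose V := fine (mu Omega).
have V0 : 0 <= V by rewrite fine_ge0.
pose d := e / (2 * (V + 1)).
have d0 : 0 < d by rewrite divr_gt0// mulr_gt0// ltr_wpDl.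
have e'0 : 0 < e / 2 * d by rewrite mulr_gt0// divr_gt0.
apply: filterS (H _ e'0) => k; set A := (X in `|X| <= _) => Ak.
have ik := square_integrable_integrable Ooo (sf_ k).
have fi := square_integrable_integrable Ooo sf.
have [mkf ikf] := square_integrableB (sf_ k) sf.
have A0 : 0 <= A by apply: Rintegral_ge0 => x _; exact: sqr_ge0.
rewrite ger0_norm// in Ak.
rewrite -RintegralB//.
have iD : integrable (fun x => f x - f_ k x) by exact: integrable_subr.
apply: le_trans (le_normr_Rintegral mO iD) _.
have i1 : integrable (fun=> d).
  by apply: (@bounded_integrable _ _ _ (fun=> d) `|d|).
have iR : integrable (fun x => d + d^-1 * (f_ k x - f x) ^+ 2).
  by apply: integrable_addr => //; exact: integrable_mulr.
apply: (@le_trans _ _ (I (fun x => d + d^-1 * (f_ k x - f x) ^+ 2))).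
  apply: le_Rintegral => //; first by move/integrable_abse : iD.
  move=> x _; rewrite distrC; set a := f_ k x - f x.
  have dd : d * d^-1 = 1 by rewrite divff// gt_eqF.
  have : 0 <= d * (1 - d^-1 * `|a|) ^+ 2 by rewrite mulr_ge0 ?sqr_ge0// ltW.
  rewrite (_ : d * _ ^+ 2 = d - 2 * (d * d^-1) * `|a| +
    (d * d^-1) * d^-1 * `|a| ^+ 2); last by ring.
  by rewrite dd real_normK ?num_real//; have := normr_ge0 a; lra.
rewrite RintegralD//; last exact: integrable_mulr.
rewrite [X in _ + X]RintegralZl// (Rintegral_cst mu mO d) -/A -/V.
have : d * V <= e / 2.
  have -> : e / 2 = d * (V + 1).
    by rewrite /d invfM mulrA mulfVK// gt_eqF// ltr_wpDl.
  by rewrite ler_pM2l// lerDl.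
have : d^-1 * A <= e / 2 by rewrite ler_pdivrMl// mulrC.
lra.
Qed.

Lemma integral_square_gt0 u : square_integrable Omega u ->
  nonzero_on Omega u -> 0 < I (fun x => u x ^+ 2).
Proof.
move=> [mu_ ui] u0; rewrite lt_neqAle Rintegral_ge0 ?andbT; last first.
  by move=> x _; exact: sqr_ge0.
apply/eqP => I0; apply: u0.
have m2 : measurable_fun Omega (EFin \o (fun x => u x ^+ 2)).
  by apply/measurable_EFinP; exact: measurable_funX.
have : (\int[mu]_(x in Omega) `|(EFin \o (fun x => (u x ^+ 2)%R)) x| = 0)%E.
  under eq_integral do rewrite gee0_abs ?lee_fin ?sqr_ge0//.
  by rewrite -[LHS]fineK ?integrable_fin_num//; congr (_%:E); exact/esym.
move/(ae_eq_integral_abs mu mO m2).1; apply: filterS => x ux Ox.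
by have /eqP := ux Ox; rewrite /= eqe sqrf_eq0 => /eqP.
Qed.

Lemma integral_square_nonzero u : measurable_fun Omega u ->
  I (fun x => u x ^+ 2) != 0 -> nonzero_on Omega u.
Proof.
move=> mu_ /eqP u0 ae0; apply: u0.
have m2 : measurable_fun Omega (EFin \o (fun x => u x ^+ 2)).
  by apply/measurable_EFinP; exact: measurable_funX.
rewrite /Rintegral (ae_eq_integral (cst 0%E))//; first by rewrite integral0.
by apply: filterS ae0 => x ux Ox; rewrite /= ux// expr0n.
Qed.

End square_integrable_functions.

(** * Reduction of both variational problems to test functions *)

Section variational.
Context {R : realType} {n : nat}.
Local Notation E := 'rV[R]_n.
Local Notation mu := (lebesgue_rV R n).
Implicit Types (x v : E) (u phi f : E -> R) (Omega : set E).

(** Taken over the whole space, so that the quotients of a test function do not mention the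
    domain. *)
Definition energy phi : R := \int[mu]_x \sum_i partial i phi x ^+ 2.

Definition gradient phi : E -> E := fun x => \row_i partial i phi x.

Lemma gradientE phi i : (fun x => gradient phi x 0 i) = partial i phi.
Proof. by apply/funext => x; rewrite mxE. Qed.

Section test_functions.
Context (Omega : set E) (oO : open Omega) (bO : bounded_set Omega).
Let mO : measurable Omega := open_measurable_rV oO.
Let Ooo : (mu Omega < +oo)%E := bounded_set_lebesgue_lty mO bO.

Lemma test_function0 phi x : test_function Omega phi -> ~ Omega x -> phi x = 0.
Proof. by move=> [_ _ sO] Ox; apply: notin_support => /sO. Qed.

Lemma test_partial0 phi i x : test_function Omega phi -> ~ Omega x ->
  partial i phi x = 0.
Proof.
by move=> [_ _ sO] Ox; apply: notin_support => /support_partial /sO.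
Qed.

Lemma test_continuous phi : test_function Omega phi ->
  continuous phi /\ compact (support_of phi).
Proof. by move=> [/(_ 0%N)[]]. Qed.

Lemma test_partial_continuous phi i : test_function Omega phi ->
  continuous (partial i phi) /\ compact (support_of (partial i phi)).
Proof.
move=> [/(_ 1%N)[_ /(_ i)[_ [? _]]] kphi _]; split=> //.
by apply: subclosed_compact kphi (@support_partial _ _ phi i); exact: closed_closure.
Qed.

Lemma Cc_square_integrable f : continuous f -> compact (support_of f) ->
  square_integrable Omega f /\ mu.-integrable setT (EFin \o (fun x => f x ^+ 2)).
Proof.
move=> cf kf; have [r r0 fr] := (compact_supportP _).1 kf.
have k2 : compact (support_of (fun x => f x ^+ 2)).
  by apply/compact_supportP; exists r => // x /fr ->; rewrite expr0n.
have c2 : continuous (fun x => f x ^+ 2) by exact: rV_continuousM.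
by split; [split; [exact: continuous_measurable_rV|]|]; exact: Cc_integrable.
Qed.

Lemma test_energyE phi : test_function Omega phi ->
  energy phi = dirichlet Omega (gradient phi).
Proof.
move=> tphi; rewrite /energy -(@Rintegral_support _ _ Omega); last first.
  by move=> x Ox; rewrite big1// => i _; rewrite (test_partial0 _ tphi)// expr0n.
by apply: eq_Rintegral => x _; apply: eq_bigr => i _; rewrite mxE.
Qed.

Lemma test_massE phi : test_function Omega phi ->
  \int[mu]_(x in Omega) phi x = \int[mu]_x phi x.
Proof. by move=> tphi; apply: Rintegral_support => x; exact: test_function0. Qed.

Lemma test_squareE phi : test_function Omega phi ->
  \int[mu]_(x in Omega) phi x ^+ 2 = \int[mu]_x phi x ^+ 2.
Proof.
move=> tphi; apply: Rintegral_support => x Ox.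
by rewrite (test_function0 tphi)// expr0n.
Qed.

Lemma test_H10 phi : test_function Omega phi -> H10 Omega phi (gradient phi).
Proof.
move=> tphi; have [cphi kphi] := test_continuous tphi.
split; last first.
  exists (fun=> phi) => //.
  rewrite (_ : (fun=> _) = cst 0); first exact: cvg_cst.
  apply/funext => k; apply: Rintegral_eq0 => // x _.
  by rewrite subrr expr0n add0r big1// => i _; rewrite mxE subrr expr0n.
split.
- exact: (Cc_square_integrable cphi kphi).1.
- move=> i; rewrite gradientE; have [cp kp] := test_partial_continuous i tphi.
  exact: (Cc_square_integrable cp kp).1.
- move=> eta i [seta keta etaO].
  rewrite [LHS]Rintegral_support; last first.
    by move=> x Ox; rewrite (test_function0 tphi)// mul0r.
  rewrite [X in - X]Rintegral_support; last first.
    by move=> x Ox; rewrite mxE (test_partial0 _ tphi)// mul0r.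
  have [sphi _ _] := tphi.
  rewrite (integral_by_parts i (sphi 1%N) (seta 1%N) kphi).
  by congr (- _); apply: eq_Rintegral => x _; rewrite mxE.
Qed.

Lemma H10_approx u g : H10 Omega u g -> exists phi : nat -> E -> R,
  [/\ forall k, test_function Omega (phi k),
    (fun k => \int[mu]_x phi k x) @ \oo --> \int[mu]_(x in Omega) u x,
    (fun k => \int[mu]_x phi k x ^+ 2) @ \oo --> \int[mu]_(x in Omega) u x ^+ 2 &
    (fun k => energy (phi k)) @ \oo --> dirichlet Omega g].
Proof.
move=> [[su sg _] [phi tphi phiug]]; exists phi.
have sphi k : square_integrable Omega (phi k).
  by have [c K] := test_continuous (tphi k); exact: (Cc_square_integrable c K).1.
have spphi k i : square_integrable Omega (partial i (phi k)).
  by have [c K] := test_partial_continuous i (tphi k); exact: (Cc_square_integrable c K).1.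
have sd k := (square_integrableB mO (sphi k) su).2.
have sdp k i := (square_integrableB mO (spphi k i) (sg i)).2.
have iS k : mu.-integrable Omega
    (EFin \o (fun x => \sum_i (partial i (phi k) x - g x 0 i) ^+ 2)).
  by apply: (integrable_sumr mO) => i; exact: sdp.
have Hu : (fun k => \int[mu]_(x in Omega) (phi k x - u x) ^+ 2) @ \oo --> (0 : R).
  apply: (squeeze_cvgr _ (cvg_cst 0) phiug); apply: nearW => k.
  rewrite Rintegral_ge0/=; last by move=> x _; exact: sqr_ge0.
  apply: le_Rintegral => //; first exact: sd.
    by apply: (integrable_addr mO) => //; exact: sd.
  by move=> x _; rewrite lerDl sumr_ge0// => i _; exact: sqr_ge0.
have Hg i : (fun k => \int[mu]_(x in Omega) (partial i (phi k) x - g x 0 i) ^+ 2)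
    @ \oo --> (0 : R).
  apply: (squeeze_cvgr _ (cvg_cst 0) phiug); apply: nearW => k.
  rewrite Rintegral_ge0/=; last by move=> x _; exact: sqr_ge0.
  apply: le_Rintegral => //; first exact: sdp.
    by apply: (integrable_addr mO) => //; exact: sd.
  move=> x _; rewrite (bigD1 i)//= addrCA lerDl addr_ge0 ?sqr_ge0//.
  by rewrite sumr_ge0// => j _; exact: sqr_ge0.
split=> //.
- under eq_fun do rewrite -test_massE//.
  exact: cvg_integral_L2.
- under eq_fun do rewrite -test_squareE//.
  exact: cvg_integral_square.
- have -> : dirichlet Omega g = \sum_i \int[mu]_(x in Omega) g x 0 i ^+ 2.
    by rewrite /dirichlet Rintegral_sumr// => i; have [] := sg i.
  rewrite (_ : (fun k => _) =
    (fun k => \sum_i \int[mu]_(x in Omega) partial i (phi k) x ^+ 2)); last first.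
    apply/funext => k; rewrite (test_energyE (tphi k)) /dirichlet.
    rewrite -Rintegral_sumr//; last by move=> i; have [] := spphi k i.
    by apply: eq_Rintegral => x _; apply: eq_bigr => i _; rewrite mxE.
  apply: cvg_sum_real => i.
  exact: cvg_integral_square.
Qed.

Definition torsion_quotients : set (\bar R) :=
  [set t | exists phi, [/\ test_function Omega phi, \int[mu]_x phi x ^+ 2 != 0 &
    t = ((\int[mu]_x phi x) ^+ 2 / energy phi)%:E]].

Definition rayleigh_quotients : set (\bar R) :=
  [set t | exists phi, [/\ test_function Omega phi, \int[mu]_x phi x ^+ 2 != 0 &
    t = (energy phi / \int[mu]_x phi x ^+ 2)%:E]].

Lemma energy_ge0 phi : 0 <= energy phi.
Proof.
by apply: Rintegral_ge0 => x _; apply: sumr_ge0 => i _; exact: sqr_ge0.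
Qed.

Lemma square_ge0 phi : 0 <= \int[mu]_x phi x ^+ 2.
Proof. by apply: Rintegral_ge0 => x _; exact: sqr_ge0. Qed.

(** The integral of [(phi - s)^2] over [Omega] is a nonnegative quadratic polynomial in [s],
    evaluated at the mean of [phi]. *)
Lemma test_cauchy_schwarz phi : test_function Omega phi ->
  (\int[mu]_x phi x) ^+ 2 <= fine (mu Omega) * \int[mu]_x phi x ^+ 2.
Proof.
move=> tphi; rewrite -test_massE// -test_squareE//.
have [cphi kphi] := test_continuous tphi.
have [mphi i2] := (Cc_square_integrable cphi kphi).1.
have i1 := Cc_integrable cphi kphi mO.
set A := \int[mu]_(x in Omega) phi x; set B := \int[mu]_(x in Omega) _ ^+ 2.
set V := fine (mu Omega).
have V0 : 0 <= V by rewrite fine_ge0.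
have H (s : R) : 0 <= B - 2 * s * A + s ^+ 2 * V.
  have ic : mu.-integrable Omega (EFin \o (fun=> s ^+ 2)).
    by apply: (@bounded_integrable _ _ _ (fun=> s ^+ 2) `|s ^+ 2|).
  have iA : mu.-integrable Omega (EFin \o (fun x => (- (2 * s)) * phi x)).
    exact: (integrable_mulr mO).
  have : 0 <= \int[mu]_(x in Omega) (phi x ^+ 2 + (- (2 * s) * phi x + s ^+ 2)).
    apply: Rintegral_ge0 => x _.
    by rewrite (_ : _ + _ = (phi x - s) ^+ 2) ?sqr_ge0//; ring.
  rewrite RintegralD//; last exact: (integrable_addr mO).
  by rewrite RintegralD// RintegralZl// (Rintegral_cst mu mO (s ^+ 2)) -/A -/B -/V; lra.
have [V00|Vn0] := eqVneq V 0.
  rewrite V00 mul0r; have [->|A0] := eqVneq A 0; first by rewrite expr0n.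
  (* If [Omega] is null the polynomial is [B - 2 s A]; at this [s] it would be -1. *)
  have := H ((B + 1) / (2 * A)); rewrite V00 mulr0 addr0.
  rewrite (_ : 2 * _ * A = B + 1); first by lra.
  by field.
have := H (A / V); rewrite (_ : B - _ + _ = B - A ^+ 2 / V); last by field.
by rewrite subr_ge0 ler_pdivrMr ?lt_neqAle ?[0 == _]eq_sym ?Vn0 1?mulrC.
Qed.

(** Otherwise Cauchy-Schwarz would give integral 0 to all the exhausting test functions, whose
    integrals tend to the positive volume of [Omega]. *)
Lemma test_nonzero_exists : Omega !=set0 ->
  exists2 phi, test_function Omega phi & \int[mu]_x phi x ^+ 2 != 0.
Proof.
move=> O0; have [chi [tchi chi01 chi1]] := test_function_exhaustion oO bO.
apply: contrapT => H.
have chi0 N : (\int[mu]_(x in Omega) (chi N x)%:E)%E = 0%E.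
  have [c k] := test_continuous (tchi N).
  have iN := Cc_integrable c k mO.
  rewrite -[LHS]fineK; last exact: integrable_fin_num.
  congr (_%:E); rewrite -[LHS]/(\int[mu]_(x in Omega) chi N x) test_massE//.
  apply/eqP; rewrite -sqrf_eq0 eq_le sqr_ge0 andbT.
  apply: le_trans (test_cauchy_schwarz (tchi N)) _.
  have [->|n0] := eqVneq (\int[mu]_x chi N x ^+ 2) 0; first by rewrite mulr0.
  by exfalso; apply: H; exists (chi N).
have := integral_exhaustion oO bO tchi chi01 chi1.
under eq_fun do rewrite chi0.
move=> /(cvg_lim (@ereal_hausdorff R)); rewrite lim_cst//.
by have := open_lebesgue_gt0 oO O0 => /[swap] <-; rewrite ltxx.
Qed.

(** Both parts of the quotient converge along an approximating sequence, whose members are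
    eventually nonzero in L^2 because the limit is. *)
Lemma torsion_testE : Omega !=set0 -> torsion Omega = ereal_sup torsion_quotients.
Proof.
move=> O0; apply/eqP; rewrite eq_le; apply/andP; split.
  apply: ge_ereal_sup => _ [u [g [ug u0 ->]]].
  have [phi [tphi phi1 phi2 phiE]] := H10_approx ug.
  (* When the denominator vanishes the quotient is 0 by the convention [x / 0 = 0], which is below
     the quotient of any test function. *)
  have [D0|D0] := eqVneq (dirichlet Omega g) 0.
    have [psi tpsi psi0] := test_nonzero_exists O0.
    rewrite D0 invr0 mulr0; apply: (@le_trans _ _ ((\int[mu]_x psi x) ^+ 2 / energy psi)%:E).
      by rewrite lee_fin divr_ge0 ?sqr_ge0 ?energy_ge0.
    by apply: ereal_sup_ubound; exists psi.
  have [[su _ _] _] := ug.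
  have U0 := integral_square_gt0 mO su u0.
  have C : (fun k => ((\int[mu]_x phi k x) ^+ 2 / energy (phi k))%:E) @ \oo -->
      ((\int[mu]_(x in Omega) u x) ^+ 2 / dirichlet Omega g)%:E.
    apply: cvg_EFin; first exact: nearW.
    by apply: cvgM; [exact: cvgM|exact: cvgV].
  apply: (cvge_to_le C).
  have : \forall k \near \oo, 0 < \int[mu]_x phi k x ^+ 2 by exact: cvgr_gt phi2 _ U0.
  apply: filterS => k k0; apply: ereal_sup_ubound; exists (phi k).
  by split=> //; rewrite gt_eqF.
apply: ge_ereal_sup => _ [phi [tphi phi0 ->]]; apply: ereal_sup_ubound.
exists phi, (gradient phi); split.
- exact: test_H10.
- apply: integral_square_nonzero => //.
    by have [c k] := test_continuous tphi; exact: continuous_measurable_rV.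
  by rewrite test_squareE.
- by rewrite test_massE// test_energyE.
Qed.

Lemma first_eigenvalue_testE : first_eigenvalue Omega = ereal_inf rayleigh_quotients.
Proof.
apply/eqP; rewrite eq_le; apply/andP; split.
  apply: le_ereal_inf_tmp => _ [phi [tphi phi0 ->]]; apply: ereal_inf_lbound.
  exists phi, (gradient phi); split.
  - exact: test_H10.
  - apply: integral_square_nonzero => //.
      by have [c k] := test_continuous tphi; exact: continuous_measurable_rV.
    by rewrite test_squareE.
  - by rewrite test_squareE// test_energyE.
apply: le_ereal_inf_tmp => _ [u [g [ug u0 ->]]].
have [phi [tphi phi1 phi2 phiE]] := H10_approx ug.
have [[su _ _] _] := ug.
have U0 := integral_square_gt0 mO su u0.
have C : (fun k => (energy (phi k) / \int[mu]_x phi k x ^+ 2)%:E) @ \oo -->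
    (dirichlet Omega g / \int[mu]_(x in Omega) u x ^+ 2)%:E.
  apply: cvg_EFin; first exact: nearW.
  by apply: cvgM => //; apply: cvgV => //; rewrite gt_eqF.
apply: (cvge_to_ge C).
have : \forall k \near \oo, 0 < \int[mu]_x phi k x ^+ 2 by exact: cvgr_gt phi2 _ U0.
apply: filterS => k k0; apply: ereal_inf_lbound; exists (phi k).
by split=> //; rewrite gt_eqF.
Qed.

End test_functions.
End variational.

(** * Monotonicity and scaling of [T] and [Lambda] *)

Section domain_functionals.
Context {R : realType} {n : nat}.
Local Notation E := 'rV[R]_n.
Local Notation mu := (lebesgue_rV R n).
Implicit Types (x v : E) (t : R) (Omega : set E).

Definition bounded_domain Omega : Prop :=
  [/\ Omega !=set0, open Omega & bounded_set Omega].

Lemma bounded_domain_aff t v Omega : 0 < t -> bounded_domain Omega ->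
  bounded_domain (aff t v @^-1` Omega).
Proof.
move=> t0 [[x Ox] oO /bounded_rVP[r r0 Or]]; split.
- by exists (aff t^-1 (- (t^-1 *: v)) x); rewrite /preimage/= affKV ?gt_eqF.
- by move/continuousP: (@continuous_aff R n t v); exact.
- apply/bounded_rVP; exists (t^-1 * (r + `|v|)).
    by rewrite mulr_gt0 ?invr_gt0// ltr_pwDl.
  move=> y /Or; rewrite /aff => yr.
  rewrite ler_pdivlMl// -{1}(gtr0_norm t0) -normrZ.
  by have := ler_normB (t *: y + v) v; rewrite addrK; lra.
Qed.

Lemma torsion_ge0 Omega : bounded_domain Omega -> (0 <= torsion Omega)%E.
Proof.
move=> [ne oO bO]; rewrite torsion_testE//.
have [psi tpsi psi0] := test_nonzero_exists oO bO ne.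
apply: (@le_trans _ _ ((\int[mu]_x psi x) ^+ 2 / energy psi)%:E).
  by rewrite lee_fin divr_ge0 ?sqr_ge0 ?energy_ge0.
by apply: ereal_sup_ubound; exists psi.
Qed.

Lemma first_eigenvalue_ge0 Omega : bounded_domain Omega ->
  (0 <= first_eigenvalue Omega)%E.
Proof.
move=> [ne oO bO]; rewrite first_eigenvalue_testE//.
apply/ereal_infP => _ [phi [_ _ ->]].
by rewrite lee_fin divr_ge0 ?energy_ge0 ?square_ge0.
Qed.

Lemma torsion_subset Omega Omega' : bounded_domain Omega ->
  bounded_domain Omega' -> Omega `<=` Omega' ->
  (torsion Omega <= torsion Omega')%E.
Proof.
move=> [ne oO bO] [ne' oO' bO'] OO'; rewrite !torsion_testE//.
apply: ereal_sup_le => _ [phi [[sphi kphi phiO] phi0 ->]].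
by exists phi; split=> //; split=> //; exact: subset_trans OO'.
Qed.

Lemma first_eigenvalue_subset Omega Omega' : bounded_domain Omega ->
  bounded_domain Omega' -> Omega `<=` Omega' ->
  (first_eigenvalue Omega' <= first_eigenvalue Omega)%E.
Proof.
move=> [ne oO bO] [ne' oO' bO'] OO'; rewrite !first_eigenvalue_testE//.
apply/ereal_infP => _ [phi [[sphi kphi phiO] phi0 ->]].
apply: ereal_inf_lbound; exists phi; split=> //; split=> //.
exact: subset_trans OO'.
Qed.

(* Already the Cauchy-Schwarz inequality [(int phi)^2 <= |Omega| int phi^2]
   bounds the product; no Poincare inequality is involved because
   [0 * +oo = 0]. *)
Lemma torsion_eigenvalue_le_volume Omega : bounded_domain Omega ->
  (torsion Omega * first_eigenvalue Omega <= mu Omega)%E.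
Proof.
move=> dO; have := torsion_ge0 dO; have := first_eigenvalue_ge0 dO.
have [ne oO bO] := dO; have mO := open_measurable_rV oO.
have Ooo := bounded_set_lebesgue_lty mO bO.
have V0 : 0 <= fine (mu Omega) by rewrite fine_ge0.
have VE : mu Omega = (fine (mu Omega))%:E by rewrite fineK// ge0_fin_numE.
rewrite VE first_eigenvalue_testE// torsion_testE//.
have [psi tpsi psi0] := test_nonzero_exists oO bO ne.
have Lub phi : test_function Omega phi -> \int[mu]_x phi x ^+ 2 != 0 ->
    (ereal_inf (rayleigh_quotients Omega) <= (energy phi / \int[mu]_x phi x ^+ 2)%:E)%E.
  by move=> tphi phi0; apply: ereal_inf_lbound; exists phi.
have := Lub _ tpsi psi0.
case: (ereal_inf _) Lub => [l||]// Lub _.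
rewrite lee_fin le_eqVlt => /predU1P[<- _|l0 _]; first by rewrite mule0 lee_fin.
rewrite -lee_pdivlMr//; apply: ge_ereal_sup => _ [phi [tphi phi0 ->]].
rewrite lee_pdivlMr// -EFinM lee_fin.
have [D0|D0] := eqVneq (energy phi) 0; first by rewrite D0 invr0 mulr0 mul0r.
have D1 : 0 < energy phi by rewrite lt_neqAle eq_sym D0 energy_ge0.
have B1 : 0 < \int[mu]_x phi x ^+ 2 by rewrite lt_neqAle eq_sym phi0 square_ge0.
have := Lub _ tphi phi0; rewrite lee_fin ler_pdivlMr// => lB.
rewrite mulrAC ler_pdivrMr//.
apply: (@le_trans _ _ (fine (mu Omega) * (l * \int[mu]_x phi x ^+ 2))).
  rewrite mulrCA mulrC ler_pM2l//.
  exact: test_cauchy_schwarz.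
by rewrite ler_wpM2l.
Qed.

(** Source of the scaling exponents: [2 n - (n - 2) = n + 2] for [T] and [(n - 2) - n = - 2] for
    [Lambda]. *)
Lemma test_function_aff t v Omega phi : 0 < t ->
  test_function (aff t v @^-1` Omega) phi ->
  let psi := phi \o aff t^-1 (- (t^-1 *: v)) in
  [/\ test_function Omega psi,
      \int[mu]_x psi x = t ^+ n * \int[mu]_x phi x,
      \int[mu]_x psi x ^+ 2 = t ^+ n * \int[mu]_x phi x ^+ 2 &
      energy psi = t ^+ n * t^-1 ^+ 2 * energy phi].
Proof.
move=> t0 tphi psi; have tN0 : t != 0 by rewrite gt_eqF.
have [sphi kphi phiO] := tphi.
have psiK x : psi (aff t v x) = phi x by rewrite /psi/= affK.
set w := - (t^-1 *: v) in psi psiK *.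
have spsi : smooth psi by move=> k; exact: Ck_aff.
have sub : support_of psi `<=` aff t^-1 w @^-1` support_of phi.
  apply: support_sub.
    apply: preimage_closed; last exact: closed_closure.
    by move=> x _; exact: continuous_aff.
  by move=> x psix; exact: subset_closure.
have kpsi : compact (support_of psi).
  have [r r0 phir] := (compact_supportP _).1 kphi.
  apply/compact_supportP; exists (t * r + `|v|) => [|x xr].
    by rewrite ltr_pwDl// mulr_gt0.
  rewrite /psi/= phir//.
  have := ler_normD (t *: aff t^-1 w x) v.
  rewrite -/(aff t v _) affKV// normrZ gtr0_norm// => H.
  by rewrite -(ltr_pM2l t0); lra.
have tpsi : test_function Omega psi.
  by split=> // x /sub /phiO; rewrite /= affKV.
have change f g : continuous f -> compact (support_of f) ->
    (forall x, f (aff t v x) = g x) ->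
    \int[mu]_x f x = t ^+ n * \int[mu]_x g x.
  move=> cf kf fg; rewrite (@Rintegral_aff R n t v setT f)//; last exact: Cc_integrable.
  by congr (_ * _); rewrite preimage_setT; apply: eq_Rintegral => x _.
have [r r0 psir] := (compact_supportP _).1 kpsi.
split=> //.
- by apply: change => //; have [] := spsi 0%N.
- apply: change; last by move=> x; rewrite psiK.
    by apply: rV_continuousM; have [] := spsi 0%N.
  by apply/compact_supportP; exists r => // x /psir ->; rewrite expr0n.
- have pE i : partial i psi = fun x => t^-1 * partial i phi (aff t^-1 w x).
    by rewrite (partial_aff _ _ (fun y => ((sphi 1%N).2 i).1 y)).2.
  rewrite /energy (change _ (fun x => t^-1 ^+ 2 * \sum_i partial i phi x ^+ 2)).
  + rewrite RintegralZl ?mulrA//.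
    apply: (integrable_sumr measurableT) => i.
    have [c k] := test_partial_continuous i tphi.
    exact: (Cc_square_integrable openT c k).2.
  + apply: rV_continuous_sum => i.
    have [c _] := test_partial_continuous i tpsi.
    exact: rV_continuousM.
  + have rp i x : r < `|x| -> partial i psi x = 0.
      move=> xr; apply: notin_support => /support_partial.
      have : support_of psi `<=` [set y | `|y| <= r].
        apply: support_sub; first exact: closed_norm_le.
        by move=> y; apply: contraNP => /negP; rewrite -ltNge => /psir ->.
      by move=> H /H /=; rewrite leNgt xr.
    apply/compact_supportP; exists r => // x xr.
    by rewrite big1// => i _; rewrite rp// expr0n.
  + move=> x; rewrite mulr_sumr; apply: eq_bigr => i _.
    by rewrite pE affK// exprMn.
Qed.

Lemma torsion_aff t v Omega : 0 < t -> bounded_domain Omega ->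
  ((t ^+ n.+2)%:E * torsion (aff t v @^-1` Omega) <= torsion Omega)%E.
Proof.
move=> t0 dO; have [ne' oO' bO'] := bounded_domain_aff v t0 dO.
have [ne oO bO] := dO.
have tn : 0 < t ^+ n by rewrite exprn_gt0.
rewrite !torsion_testE// -lee_pdivlMl ?exprn_gt0//.
apply: ge_ereal_sup => _ [phi [tphi phi0 ->]].
rewrite lee_pdivlMl ?exprn_gt0//; apply: ereal_sup_ubound.
have [tpsi A B D] := test_function_aff t0 tphi.
eexists; split; first exact: tpsi.
  by rewrite B mulf_neq0// gt_eqF.
rewrite A D -EFinM; congr (_%:E).
have [D0|D0] := eqVneq (energy phi) 0; first by rewrite D0 !mulr0 invr0 !mulr0.
have t00 : t != 0 by rewrite gt_eqF.
have tn0 : t ^+ n != 0 by rewrite gt_eqF.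
rewrite -[n.+2]addn2 exprD; field.
by rewrite D0 t00 tn0.
Qed.

Lemma first_eigenvalue_aff t v Omega : 0 < t -> bounded_domain Omega ->
  (first_eigenvalue Omega <=
   (t^-1 ^+ 2)%:E * first_eigenvalue (aff t v @^-1` Omega))%E.
Proof.
move=> t0 dO; have [ne' oO' bO'] := bounded_domain_aff v t0 dO.
have [ne oO bO] := dO.
have ti : 0 < t^-1 by rewrite invr_gt0.
rewrite !first_eigenvalue_testE// -lee_pdivrMl ?exprn_gt0//.
apply/ereal_infP => _ [phi [tphi phi0 ->]].
rewrite lee_pdivrMl ?exprn_gt0//; apply: ereal_inf_lbound.
have [tpsi A B D] := test_function_aff t0 tphi.
eexists; split; first exact: tpsi.
  by rewrite B mulf_neq0// gt_eqF// exprn_gt0.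
rewrite B D -EFinM; congr (_%:E).
have t00 : t != 0 by rewrite gt_eqF.
have tn0 : t ^+ n != 0 by rewrite gt_eqF// exprn_gt0.
by field; rewrite phi0 t00 tn0.
Qed.

Lemma aff_preimageK t v Omega : t != 0 ->
  aff t^-1 (- (t^-1 *: v)) @^-1` (aff t v @^-1` Omega) = Omega.
Proof. by move=> t0; apply/seteqP; split=> x; rewrite /preimage/= affKV. Qed.

End domain_functionals.

(** * Upper bounds and scale invariance of [G] *)

Section G_bounds.
Context {R : realType} {n : nat} (hn : (2 <= n)%N).
Local Notation E := 'rV[R]_n.
Local Notation mu := (lebesgue_rV R n).
Implicit Types (x v : E) (t : R) (Omega : set E).
Local Notation alpha := (n%:R / (n%:R - 1) : R).

Lemma pred_dim_gt0 : 0 < n%:R - 1 :> R.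
Proof. by rewrite subr_gt0 ltr1n. Qed.

Lemma alpha_gt0 : 0 < alpha.
Proof. by rewrite divr_gt0 ?pred_dim_gt0// ltr0n (leq_trans _ hn). Qed.

Lemma expr_pred_powR t : 0 < t -> (t ^+ n.-1) `^ (n%:R - 1)^-1 = t.
Proof.
move=> t0; rewrite -powR_mulrn ?ltW// -powRrM.
have -> : (n.-1)%:R = n%:R - 1 :> R by rewrite -subn1 natrB// ltnW.
by rewrite divff ?powRr1 ?ltW// gt_eqF// pred_dim_gt0.
Qed.

(** The reason for the exponent in [G]: the perimeter scales by [t ^+ n / t], the product [T Lambda]
    by [t ^+ n]. *)
Lemma expr_alpha t : 0 < t -> (t ^+ n / t) `^ alpha = t ^+ n.
Proof.
move=> t0; have -> : t ^+ n / t = t ^+ n.-1.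
  by rewrite -{1}(prednK (leq_trans _ hn : (0 < n)%N))// exprSr mulfK// gt_eqF.
rewrite mulrC powRrM expr_pred_powR// powR_mulrn// ltW//.
Qed.

(** The left side is the bound on [G] resulting from [T Lambda <= V] and [P >= V / t]. The right
    side follows from [alpha = 1 + 1 / (n - 1)]. *)
Lemma volume_div_powR (V t : R) : 0 < V -> 0 < t ->
  V / (V / t) `^ alpha = (V^-1 * t ^+ n) `^ (n%:R - 1)^-1.
Proof.
move=> V0 t0; have k0 := pred_dim_gt0; have kN0 : n%:R - 1 != 0 :> R by rewrite gt_eqF.
have -> : alpha = 1 + (n%:R - 1)^-1 by field.
have Vt0 : 0 < V / t by rewrite divr_gt0.
have tV0 : 0 < t / V by rewrite divr_gt0.
rewrite powRD; last by rewrite (gt_eqF Vt0) implybT.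
rewrite powRr1 ?ltW//.
have -> : V^-1 * t ^+ n = (t / V) * t ^+ n.-1.
  by rewrite -{1}(prednK (leq_trans _ hn : (0 < n)%N))// exprS; ring.
rewrite (powRM _ (ltW tV0)); last by rewrite exprn_ge0// ltW.
rewrite expr_pred_powR//.
have : (V / t) `^ (n%:R - 1)^-1 * (t / V) `^ (n%:R - 1)^-1 = 1.
  by rewrite -powRM ?ltW// mulrA divfK ?divff ?powR1// gt_eqF.
have : 0 < (V / t) `^ (n%:R - 1)^-1 by rewrite powR_gt0.
move: (_ `^ _) (_ `^ _) => a b a0 ab.
have -> : a = b^-1 by rewrite -[b^-1]mulr1 -ab mulKf// gt_eqF.
by field; rewrite !gt_eqF.
Qed.

Lemma poweR_alpha_le (x y : \bar R) : (0 <= x)%E -> (x <= y)%E ->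
  (x `^ alpha <= y `^ alpha)%E.
Proof.
move=> x0 xy; have a0 := ltW alpha_gt0.
by apply: (gt0_ler_poweR a0) => //; rewrite in_itv/= leey andbT// (le_trans x0).
Qed.

Lemma inve_le (r : R) (y : \bar R) : 0 < r -> (r%:E <= y)%E ->
  (y^-1 <= (r^-1)%:E)%E.
Proof.
move=> r0 ry; have -> : (r^-1)%:E = (r%:E^-1)%E :> \bar R by rewrite inver gt_eqF.
have r0' : (0 <= r%:E)%E by rewrite lee_fin ltW.
by rewrite lee_pV2// inE (le_trans r0').
Qed.

Lemma G_ge0 Omega : bounded_domain Omega -> (0 <= G Omega)%E.
Proof.
move=> dO; rewrite /G !mule_ge0 ?torsion_ge0 ?first_eigenvalue_ge0//.
by rewrite inve_ge0 poweR_ge0.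
Qed.

Lemma G_le (q p : R) Omega : 0 < p ->
  bounded_domain Omega ->
  (torsion Omega * first_eigenvalue Omega <= q%:E)%E ->
  (p%:E <= perimeter Omega)%E -> (G Omega <= (q / p `^ alpha)%:E)%E.
Proof.
move=> p0 dO TL P; rewrite /G EFinM.
have pa0 : 0 < p `^ alpha by rewrite powR_gt0.
apply: lee_pmul => //.
- by rewrite mule_ge0 ?torsion_ge0 ?first_eigenvalue_ge0.
- by rewrite inve_ge0 poweR_ge0.
- apply: inve_le => //; rewrite -poweR_EFin; apply: poweR_alpha_le => //.
  by rewrite lee_fin ltW.
Qed.

Lemma volume_gt0 Omega : bounded_domain Omega ->
  [/\ measurable Omega, 0 < fine (mu Omega) & mu Omega = (fine (mu Omega))%:E].
Proof.
move=> [ne oO bO]; have mO := open_measurable_rV oO.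
have Ooo := bounded_set_lebesgue_lty mO bO; have V0 := open_lebesgue_gt0 oO ne.
split=> //; first by rewrite fine_gt0// V0.
by rewrite fineK// ge0_fin_numE.
Qed.

Lemma perimeter_shift_ge Omega (i : 'I_n) t : bounded_domain Omega -> 0 < t ->
  (forall x, Omega x -> ~ Omega (x + t *: delta_mx 0 i)) ->
  ((fine (mu Omega) / t)%:E <= perimeter Omega)%E.
Proof.
move=> dO t0 Ot; have [_ _ VE] := volume_gt0 dO; have [ne oO bO] := dO.
have := perimeter_shift oO bO t0 Ot; rewrite VE -lee_pdivrMl// => H.
by rewrite mulrC EFinM.
Qed.

Lemma G_le_shift Omega (i : 'I_n) t : bounded_domain Omega -> 0 < t ->
  (forall x, Omega x -> ~ Omega (x + t *: delta_mx 0 i)) ->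
  (G Omega <= (((fine (mu Omega))^-1 * t ^+ n) `^ (n%:R - 1)^-1)%:E)%E.
Proof.
move=> dO t0 Ot; have [mO V0 VE] := volume_gt0 dO.
rewrite -volume_div_powR//; apply: G_le => //; first by rewrite divr_gt0.
  by rewrite -VE; exact: torsion_eigenvalue_le_volume.
exact: perimeter_shift_ge Ot.
Qed.

Lemma bounded_shift_disjoint Omega (i : 'I_n) : bounded_set Omega ->
  exists2 t, 0 < t & forall x, Omega x -> ~ Omega (x + t *: delta_mx 0 i).
Proof.
(* The diameter is at most [2 * r]. *)
move=> /bounded_rVP[r r0 Or]; exists (3 * r); first by rewrite mulr_gt0.
move=> x /Or xr /Or xtr.
have := ler_normB (x + (3 * r) *: delta_mx 0 i) x.
rewrite addrAC subrr add0r norm_scale_delta ger0_norm; last by rewrite mulr_ge0// ltW.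
lra.
Qed.

Lemma perimeter_gt0 Omega : bounded_domain Omega -> (0 < perimeter Omega)%E.
Proof.
move=> dO; have [mO V0 VE] := volume_gt0 dO; have [ne oO bO] := dO.
have [t t0 Ot] := bounded_shift_disjoint (Ordinal (leq_trans (isT : 0 < 2)%N hn)) bO.
by apply: lt_le_trans (perimeter_shift_ge dO t0 Ot); rewrite lte_fin divr_gt0.
Qed.

Lemma G_fin_num Omega : bounded_domain Omega -> G Omega \is a fin_num.
Proof.
move=> dO; have [ne oO bO] := dO.
have [t t0 Ot] := bounded_shift_disjoint (Ordinal (leq_trans (isT : 0 < 2)%N hn)) bO.
rewrite ge0_fin_numE ?G_ge0//.
exact: le_lt_trans (G_le_shift dO t0 Ot) (ltry _).
Qed.

(** Contrapositive of [G_le_shift]: the condition on [t] says that the bound given there is at most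
    [a]. In a convex set the two points are the ends of a chord of length [t]. *)
Lemma shift_meets Omega (a t : R) (i : 'I_n) : bounded_domain Omega ->
  0 < a -> 0 < t -> (a%:E < G Omega)%E ->
  t ^+ n <= a ^+ n.-1 * fine (mu Omega) ->
  exists2 x, Omega x & Omega (x + t *: delta_mx 0 i).
Proof.
move=> dO a0 t0 aG tV; apply: contrapT => H.
have [_ V0 _] := volume_gt0 dO.
have : (G Omega <= a%:E)%E.
  apply: (le_trans (G_le_shift dO t0 _)); last first.
    rewrite lee_fin -[leRHS](expr_pred_powR a0).
    have k0 : 0 <= (n%:R - 1)^-1 :> R by rewrite invr_ge0 ltW// pred_dim_gt0.
    apply: (ge0_ler_powR k0); rewrite ?nnegrE.
    - by apply: mulr_ge0; rewrite ?invr_ge0 ?exprn_ge0// ltW.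
    - by rewrite exprn_ge0// ltW.
    - by rewrite ler_pdivrMl// mulrC.
  by move=> x Ox Oxt; apply: H; exists x => //; exact: Oxt.
by rewrite leNgt aG.
Qed.

Lemma G_aff t v Omega : 0 < t -> bounded_domain Omega ->
  (G Omega <= G (aff t v @^-1` Omega))%E.
Proof.
move=> t0 dO; have dO' := bounded_domain_aff v t0 dO.
have tN0 : t != 0 by rewrite gt_eqF.
have [mO _ _] := volume_gt0 dO; have [mO' _ _] := volume_gt0 dO'.
have ti0 : 0 < t^-1 by rewrite invr_gt0.
(* The opposite inequality of the scaling law is [torsion_aff] for the inverse homothety. *)
have T : (torsion Omega <= (t ^+ n.+2)%:E * torsion (aff t v @^-1` Omega))%E.
  have := torsion_aff (- (t^-1 *: v)) ti0 dO'.
  by rewrite aff_preimageK// exprVn lee_pdivrMl ?exprn_gt0.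
have L := first_eigenvalue_aff v t0 dO.
have P := perimeter_aff v t0 mO.
have P'0 := perimeter_gt0 dO'.
have T0 := torsion_ge0 dO; have T0' := torsion_ge0 dO'.
have L0 := first_eigenvalue_ge0 dO; have L0' := first_eigenvalue_ge0 dO'.
have TL : (torsion Omega * first_eigenvalue Omega <= (t ^+ n)%:E *
    (torsion (aff t v @^-1` Omega) * first_eigenvalue (aff t v @^-1` Omega)))%E.
  apply: (le_trans (lee_pmul T0 L0 T L)); rewrite muleACA -EFinM.
  rewrite -[n.+2]addn2 exprD exprVn mulfK//.
  by rewrite expf_neq0.
rewrite /G.
have tn0 : 0 < t ^+ n / t by rewrite divr_gt0 ?exprn_gt0.
(* If this perimeter is infinite, so is that of [Omega], and both values of [G] are 0. *)
case: (perimeter (aff t v @^-1` Omega)) P P'0 => [p||]// P p0; last first.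
  move: P; rewrite gt0_muley ?lte_fin// leye_eq => /eqP ->.
  have -> : (+oo `^ alpha)%E = +oo%E :> \bar R.
    by apply: poweRyr; rewrite gt_eqF// alpha_gt0.
  by have -> : (+oo^-1)%E = 0%E :> \bar R by []; rewrite !mule0.
rewrite lte_fin in p0.
rewrite -EFinM in P.
have a0 : 0 < p `^ alpha by rewrite powR_gt0.
apply: (@le_trans _ _ ((t ^+ n)%:E * (torsion (aff t v @^-1` Omega) *
    first_eigenvalue (aff t v @^-1` Omega)) *
   ((t ^+ n * p `^ alpha)^-1)%:E)%E).
  apply: lee_pmul => //; first by rewrite mule_ge0.
    by rewrite inve_ge0 poweR_ge0.
  have ta0 : 0 < t ^+ n * p `^ alpha by rewrite mulr_gt0 ?exprn_gt0.
  apply: inve_le => //; rewrite -{1}(expr_alpha t0) -powRM ?(ltW p0) ?(ltW tn0)// -poweR_EFin.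
  by apply: poweR_alpha_le => //; rewrite lee_fin mulr_ge0// ltW.
rewrite poweR_EFin inver gt_eqF// invfM EFinM muleACA -EFinM.
by rewrite divff ?mul1e// expf_neq0.
Qed.

End G_bounds.

(** * Convex sets and normalised domains *)

Section convex_geometry.
Context {R : realType} {n : nat}.
Local Notation E := 'rV[R]_n.
Local Notation mu := (lebesgue_rV R n).
Implicit Types (x y z v g : E) (r s t : R) (Omega : set E).

Lemma convex_setP Omega : convex_set Omega <->
  forall x y s, Omega x -> Omega y -> 0 <= s <= 1 ->
    Omega (s *: x + (1 - s) *: y).
Proof.
split=> [cO x y s Ox Oy s01|cO x y l].
  have := cO x y (Itv01 (andP s01).1 (andP s01).2) (mem_set Ox) (mem_set Oy).
  by rewrite inE.
rewrite !inE => Ox Oy; apply: cO => //.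
by rewrite ge0 le1.
Qed.

Lemma convex_mean Omega N (p : 'I_N.+1 -> E) : convex_set Omega ->
  (forall i, Omega (p i)) -> Omega (N.+1%:R^-1 *: \sum_i p i).
Proof.
move=> /convex_setP cO; elim: N p => [|N IH] p Op.
  by rewrite big_ord1 invr1 scale1r.
rewrite big_ord_recr/=.
have N0 : N.+1%:R != 0 :> R by rewrite pnatr_eq0.
have M0 : N.+2%:R != 0 :> R by rewrite pnatr_eq0.
have NM : N.+2%:R = N.+1%:R + 1 :> R by rewrite -natr1.
have -> : N.+2%:R^-1 *: (\sum_(i < N.+1) p (widen_ord (leqnSn N.+1) i) + p ord_max) =
  (N.+1%:R / N.+2%:R) *: (N.+1%:R^-1 *: \sum_(i < N.+1) p (widen_ord (leqnSn N.+1) i)) +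
  (1 - N.+1%:R / N.+2%:R) *: p ord_max :> E.
  rewrite scalerDr scalerA; congr (_ *: _ + _ *: _).
    by rewrite mulrAC divff// mul1r.
  by rewrite NM in M0 *; field.
apply: cO => //; first exact: IH.
by rewrite divr_ge0//= ler_pdivrMr// mul1r ler_nat.
Qed.

(** [y] is a combination of [x] and of a point of the ball around 0, with weights [s] and [1 - s].
    Each [s *: x] thus has a margin [(1 - s) * r] inside [Omega], in which later approximations are
    absorbed. *)
Lemma homothety_sub Omega x r s y : convex_set Omega ->
  Omega x -> (forall z, `|z| < r -> Omega z) -> 0 < s < 1 ->
  `|y - s *: x| < (1 - s) * r -> Omega y.
Proof.
move=> /convex_setP cO Ox Or /andP[s0 s1] yx.
have s1' : 0 < 1 - s by rewrite subr_gt0.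
have -> : y = s *: x + (1 - s) *: ((1 - s)^-1 *: (y - s *: x)).
  by rewrite scalerA divff ?gt_eqF// scale1r addrC subrK.
apply: cO => //; last by rewrite !ltW.
by apply: Or; rewrite normrZ gtr0_norm ?invr_gt0// ltr_pdivrMl.
Qed.

End convex_geometry.

(** * Inner radius from chords, outer radius from volume *)

Section ball_in_domain.
Context {R : realType} {n : nat}.
Local Notation E := 'rV[R]_n.+1.
Local Notation mu := (lebesgue_rV R n.+1).
Implicit Types (x y z v g : E) (r s t : R) (Omega : set E).

Lemma segment_midpoint g v (h e : R) : h != 0 ->
  g + e *: v = ((e + h) / (2 * h)) *: (g + h *: v) +
    (1 - (e + h) / (2 * h)) *: (g + (- h) *: v).
Proof. by move=> h0; apply/rowP => j; rewrite !mxE; field. Qed.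

(* The mean [g] of the midpoints of the chords [b_i, b_i + rho e_i] works:
   replacing the i-th midpoint by one of its endpoints moves [g] by
   [+- rho / (2 (n + 1)) e_i]. *)
Lemma chords_inner_ball Omega (rho : R) : convex_set Omega -> 0 < rho ->
  (forall i, exists2 x, Omega x & Omega (x + rho *: delta_mx 0 i)) ->
  exists2 g, Omega g &
    forall y, `|y - g| < rho / (2 * n.+1%:R ^+ 2) -> Omega y.
Proof.
move=> cO rho0 H.
have H' i : exists x, Omega x /\ Omega (x + rho *: delta_mx 0 i).
  by have [x Ox Oxi] := H i; exists x.
have [b bO] := choice H'.
have cO' := (convex_setP Omega).1 cO.
have half01 : 0 <= (2^-1 : R) <= 1 by lra.
pose c i := b i + (rho / 2) *: delta_mx 0 i.
have cE i : c i = 2^-1 *: b i + (1 - 2^-1) *: (b i + rho *: delta_mx 0 i).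
  rewrite /c scalerDr addrA -scalerDl scalerA; congr (_ + _ *: _); last by field.
  by rewrite (_ : _ + _ = 1) ?scale1r//; field.
have cOm i : Omega (c i) by rewrite cE; apply: cO' => //; have [] := bO i.
pose g := n.+1%:R^-1 *: \sum_i c i.
have N0 : n.+1%:R != 0 :> R by rewrite pnatr_eq0.
have Npos : 0 < n.+1%:R :> R by rewrite ltr0n.
have gend i (e : R) : Omega (c i + e *: delta_mx 0 i) ->
    Omega (g + (e / n.+1%:R) *: delta_mx 0 i).
  move=> ci; rewrite (_ : g + _ = n.+1%:R^-1 *:
    \sum_j (if j == i then c i + e *: delta_mx 0 i else c j)).
    by apply: convex_mean => // j; case: ifP.
  rewrite [in RHS](bigD1 i)//= eqxx /g (bigD1 i)//=.
  rewrite [in RHS](eq_bigr c); last by move=> j /negbTE ->.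
  by rewrite [in RHS]addrAC [in RHS]scalerDr scalerA mulrC.
pose h := rho / (2 * n.+1%:R).
have gp i : Omega (g + h *: delta_mx 0 i).
  rewrite /h invfM mulrA; apply: gend; rewrite /c -addrA -scalerDl.
  by rewrite -splitr; have [] := bO i.
have gm i : Omega (g + (- h) *: delta_mx 0 i).
  rewrite /h invfM mulrA -mulNr; apply: gend; rewrite /c -addrA -scalerDl.
  by rewrite subrr scale0r addr0; have [] := bO i.
have h0 : 0 < h by rewrite divr_gt0// mulr_gt0.
have gs i (e : R) : `|e| <= h -> Omega (g + e *: delta_mx 0 i).
  rewrite ler_norml => /andP[he eh].
  pose s := (e + h) / (2 * h).
  rewrite (_ : g + _ = s *: (g + h *: delta_mx 0 i) + (1 - s) *: (g + (- h) *: delta_mx 0 i)).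
    apply: cO' => //; rewrite /s divr_ge0/= ?ler_pdivrMr ?mulr_gt0//; lra.
  by apply: segment_midpoint; rewrite gt_eqF.
exists g; first exact: convex_mean.
move=> y yg.
(* [y] is the mean of [n + 1] points, one on each axis through [g]. Their offsets are [n + 1] times
   the coordinates of [y - g], which accounts for the square in the radius. *)
have -> : y = n.+1%:R^-1 *: \sum_i (g + (n.+1%:R * (y - g) 0 i) *: delta_mx 0 i).
  rewrite big_split/= sumr_const card_ord scalerDr -[g *+ _]scaler_nat.
  rewrite [X in X + _]scalerA mulVf// scale1r.
  under eq_bigr do rewrite -scalerA.
  rewrite -scaler_sumr scalerA mulVf// scale1r.
  by rewrite -[X in _ = _ + X]row_sum_delta addrC subrK.
apply: convex_mean => // i; apply: gs; rewrite normrM ger0_norm//.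
rewrite -ler_pdivlMl//; apply: le_trans (ler_coord_norm _ i) _.
apply: le_trans (ltW yg) _.
by rewrite /h (_ : rho / (2 * n.+1%:R ^+ 2) = n.+1%:R^-1 * (rho / (2 * n.+1%:R)))//; field.
Qed.

(* Otherwise [N] disjoint cubes of side [r], centered on the first half of the
   segment from [g] to [x], would fit in [Omega]. *)
Lemma volume_bounds_radius Omega g r (N : nat) : convex_set Omega ->
  measurable Omega -> 0 < r -> (0 < N)%N -> (forall y, `|y - g| < r -> Omega y) ->
  (mu Omega < (N%:R * r ^+ n.+1)%:E)%E ->
  forall x, Omega x -> `|x - g| < 2 * N%:R * r.
Proof.
move=> /convex_setP cO mO r0 N0 Og V x Ox; rewrite ltNge; apply/negP => xg.
have Npos : 0 < N%:R :> R by rewrite ltr0n.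
have d0 : 0 < `|x - g| by apply: lt_le_trans xg; rewrite !mulr_gt0.
have [i xi] := rV_norm_coord d0.
pose c k : E := g + (k%:R / (2 * N%:R)) *: (x - g).
pose Q k := cube (c k) (r / 2).
have r20 : 0 <= r / 2 by rewrite divr_ge0// ltW.
(* As [c k] divides the segment at a ratio [t < 1 / 2], the ball of radius [r] around [g] still
   contributes radius [(1 - t) * r > r / 2] there. *)
have QO k : (k < N)%N -> Q k `<=` Omega.
  move=> kN y /(cube_norm_le r20) yk.
  pose t : R := k%:R / (2 * N%:R).
  have t0 : 0 <= t by rewrite divr_ge0// mulr_ge0// ltW.
  have t1 : t < 2^-1.
    rewrite ltr_pdivrMr ?mulr_gt0// mulrA mulVf// mul1r ltr_nat; exact: kN.
  have t1' : 0 < 1 - t by lra.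
  have -> : y = t *: x + (1 - t) *: (g + (1 - t)^-1 *: (y - c k)).
    rewrite scalerDr scalerA divff ?gt_eqF// scale1r /c -/t scalerBl scale1r.
    rewrite scalerBr opprD opprB !addrA; apply/rowP => j; rewrite !mxE; ring.
  apply: cO => //; last by apply/andP; lra.
  apply: Og; rewrite addrAC subrr add0r normrZ gtr0_norm ?invr_gt0// ltr_pdivrMl//.
  by apply: le_lt_trans yk _; rewrite [r / 2]mulrC ltr_pM2r//; lra.
(* In the coordinate [i], where [x - g] attains its norm, successive centres are at least [r] apart.
   The cubes are half-open, so they are disjoint even if they touch. *)
have disj : trivIset setT Q.
  apply: ltn_trivIset => k m mk; apply/seteqP; split=> // y [ym yk].
  have := ym i; have := yk i; rewrite !mxE.
  set D := x 0 i - g 0 i; set u := D / (2 * N%:R).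
  have ru : r <= `|u|.
    rewrite normrM [X in _ * X]ger0_norm; last by rewrite invr_ge0 mulr_ge0// ltW.
    have -> : `|D| = `|x - g| by rewrite -xi !mxE.
    by rewrite ler_pdivlMr ?mulr_gt0// mulrC.
  rewrite (_ : k%:R / _ * D = k%:R * u); last by rewrite /u; ring.
  rewrite (_ : m%:R / _ * D = m%:R * u); last by rewrite /u; ring.
  have kE : k%:R = m%:R + 1 + (k - m.+1)%:R :> R.
    by rewrite natr1 -natrD subnKC.
  have w0 : 0 <= (k - m.+1)%:R :> R by [].
  move: ru; rewrite ler_normr kE => /orP[ru|ru].
    have : 0 <= (k - m.+1)%:R * u by rewrite mulr_ge0//; lra.
    by move=> ? /andP[? ?] /andP[? ?]; lra.
  have : 0 <= (k - m.+1)%:R * - u by rewrite mulr_ge0//; lra.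
  by move=> ? /andP[? ?] /andP[? ?]; lra.
have mQ k : measurable (Q k) by exact: measurable_cube.
have : (mu (\big[setU/set0]_(k < N) Q k) <= mu Omega)%E.
  apply: le_measure; rewrite ?inE//; first exact: bigsetU_measurable.
  by rewrite -bigcup_mkord => y [k /= kN]; exact: QO.
rewrite measure_bigsetU// leNgt.
rewrite (eq_bigr (fun=> (r ^+ n.+1)%:E)); last first.
  move=> k _; rewrite [LHS]lebesgue_cube//.
  by rewrite (_ : r / 2 *+ 2 = r)//; field.
by rewrite sumEFin sumr_const card_ord -mulr_natl V.
Qed.

End ball_in_domain.

(** * Normalised domains, boxes and finite nets *)

Section normalisation.
Context {R : realType} {n : nat}.
Local Notation E := 'rV[R]_n.
Local Notation mu := (lebesgue_rV R n).
Implicit Types (x y z v g : E) (r s t : R) (Omega : set E).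

Lemma convex_domain_bounded Omega : convex_domain Omega -> bounded_domain Omega.
Proof. by move=> []. Qed.

Lemma convex_domain_aff t v Omega : 0 < t -> convex_domain Omega ->
  convex_domain (aff t v @^-1` Omega).
Proof.
move=> t0 dO; have [ne oO bO] := bounded_domain_aff v t0 (convex_domain_bounded dO).
have [_ _ _ /convex_setP cO] := dO.
split=> //; apply/convex_setP => x y s Ox Oy s01; rewrite /preimage/=.
rewrite (_ : aff t v _ = s *: aff t v x + (1 - s) *: aff t v y).
  exact: cO.
by apply/rowP => j; rewrite !mxE; ring.
Qed.

Definition normalised r Omega : Prop :=
  [/\ convex_domain Omega, forall x, `|x| < r -> Omega x &
      forall x, Omega x -> `|x| <= 1].

Definition open_box (l : 'I_n -> R) : set E := [set x | forall i, 0 < x 0 i < l i].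

Lemma convex_domain_open_box (l : 'I_n -> R) : (forall i, 0 < l i) ->
  convex_domain (open_box l).
Proof.
move=> l0; split.
- by exists (\row_i (l i / 2)) => i; rewrite mxE; have := l0 i; lra.
- rewrite openE => x lx; exists (fun _ j => `]0, l j[%classic).
    move=> i j; apply: open_nbhs_nbhs; split; first exact: interval_open.
    by rewrite /= in_itv/= ord1; exact: lx.
  by move=> y ly i; have := ly 0 i; rewrite /= in_itv.
- apply/bounded_rVP; exists (\sum_i l i + 1).
    by rewrite ltr_wpDl// sumr_ge0// => i _; rewrite ltW.
  move=> x lx; have s0 : 0 <= \sum_i l i + 1.
    by rewrite addr_ge0// sumr_ge0// => i _; rewrite ltW.
  apply: rV_norm_le => // i; have /andP[xi xl] := lx i.
  rewrite ger0_norm ?ltW//; apply: lt_trans xl _.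
  rewrite (bigD1 i)//= -addrA ltrDl ltr_wpDl// sumr_ge0// => j _; exact: ltW.
- apply/convex_setP => x y s lx ly /andP[s0 s1] i; rewrite !mxE.
  have /andP[x0 xl] := lx i; have /andP[y0 yl] := ly i.
  have [->|sp] := eqVneq s 0; first by rewrite mul0r add0r subr0 mul1r y0.
  have sp' : 0 < s by rewrite lt_neqAle eq_sym sp.
  have := mulr_gt0 sp' x0; have : 0 < s * (l i - x 0 i) by rewrite mulr_gt0// subr_gt0.
  have : 0 <= (1 - s) * y 0 i by rewrite mulr_ge0 ?subr_ge0// ltW.
  have : 0 <= (1 - s) * (l i - y 0 i) by rewrite mulr_ge0 ?subr_ge0// ltW.
  by move=> ? ? ? ?; apply/andP; lra.
Qed.

Lemma lebesgue_open_box (l : 'I_n -> R) : (forall i, 0 < l i) ->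
  mu (open_box l) = (\prod_i l i)%:E.
Proof.
move=> l0.
rewrite (_ : open_box l = [set x : E | forall i, `]0, l i[%classic (x 0 i)]).
  rewrite (@lebesgue_rV_box R n (fun i => `]0, l i[%classic)); last first.
    by move=> i; exact: measurable_itv.
  rewrite -prodEFin; apply: eq_bigr => i _.
  by rewrite lebesgue_measure_itv/= lte_fin l0 oppr0 adde0.
by apply/seteqP; split=> x lx i; have := lx i; rewrite /= in_itv.
Qed.

Lemma finite_net r (eta : R) : 0 < eta ->
  exists2 F : set E, finite_set F &
    forall x, `|x| <= r -> exists2 f, F f & `|x - f| < eta.
Proof.
move=> eta0.
have : compact [set x : E | `|x| <= r].
  apply: bounded_closed_compact; last exact: closed_norm_le.
  apply/bounded_rVP; exists (`|r| + 1); first by rewrite ltr_wpDl.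
  by move=> x /= /le_trans; apply; rewrite (le_trans (ler_norm r))// lerDl.
rewrite compact_cover => /(_ E setT (fun f => [set x | `|x - f| < eta]))[].
- move=> f _; apply/open_rVP => x /= xf; exists (eta - `|x - f|).
    by rewrite subr_gt0.
  move=> y yx; have := ler_normD (y - x) (x - f).
  by rewrite addrA subrK; lra.
- by move=> x _; exists x => //=; rewrite subrr normr0.
- move=> F _ HF; eexists; first exact: (finite_fset F).
  by move=> x xr; have [f /= fF xf] := HF _ xr; exists f.
Qed.

End normalisation.

Lemma normalise {R : realType} (n : nat) (hn : (2 <= n)%N) (a : R) : 0 < a ->
  exists2 r : R, 0 < r & forall Omega : set 'rV[R]_n, convex_domain Omega ->
    (a%:E < G Omega)%E ->
    exists2 Omega' : set 'rV[R]_n, normalised r Omega' & (G Omega <= G Omega')%E.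
Proof.
case: n hn => // n hn a0.
(* [K] is the ratio of the volume of [Omega] to [r0 ^+ n.+1], with [r0] the inner radius found
   below. It depends only on [n] and [a], hence so does the final radius. *)
pose K : R := (2 * n.+1%:R ^+ 2) ^+ n.+1 / a ^+ n.
pose N := (Num.truncn K).+1.
have KN : K < N%:R by exact: truncnS_gt.
have N0 : 0 < N%:R :> R by rewrite ltr0n.
exists (2 * N%:R)^-1; first by rewrite invr_gt0 mulr_gt0.
move=> Omega cdO aG; have dO := convex_domain_bounded cdO.
have [_ _ _ cO] := cdO.
have [mO V0 VE] := volume_gt0 dO; set V := fine _ in V0 VE.
have an0 : 0 < a ^+ n by rewrite exprn_gt0.
(* The longest chord that [shift_meets] provides. *)
pose rho := (a ^+ n * V) `^ n.+1%:R^-1.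
have rho0 : 0 < rho by rewrite powR_gt0// mulr_gt0.
have rhoE : rho ^+ n.+1 = a ^+ n * V.
  rewrite -powR_mulrn ?ltW// /rho -powRrM mulVf ?pnatr_eq0// powRr1// mulr_ge0// ltW//.
have [g Og gball] : exists2 g, Omega g &
    forall y, `|y - g| < rho / (2 * n.+1%:R ^+ 2) -> Omega y.
  apply: chords_inner_ball => // i.
  by apply: (@shift_meets _ _ hn Omega a rho i dO a0 rho0 aG); rewrite rhoE.
set r0 := rho / _ in gball.
have D0 : 0 < 2 * n.+1%:R ^+ 2 :> R by rewrite mulr_gt0// exprn_gt0// ltr0n.
have r00 : 0 < r0 by rewrite divr_gt0.
have outer : forall x, Omega x -> `|x - g| < 2 * N%:R * r0.
  apply: volume_bounds_radius => //.
  rewrite VE lte_fin /r0 expr_div_n rhoE mulrA ltr_pdivlMr ?exprn_gt0//.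
  rewrite [ltLHS]mulrC mulrA ltr_pM2r//.
  by move: KN; rewrite /K ltr_pdivrMr.
have R0 : 0 < 2 * N%:R * r0 by rewrite !mulr_gt0.
(* The outer radius [2 * N%:R * r0] becomes 1 and the inner radius [r0] becomes [(2 * N%:R)^-1]. *)
exists (aff (2 * N%:R * r0) g @^-1` Omega); last exact: G_aff.
split; first exact: convex_domain_aff.
- move=> x xr; apply: gball; rewrite /aff addrK normrZ gtr0_norm//.
  by rewrite mulrAC mulrC -ltr_pdivlMl// mulVf ?gt_eqF// -ltr_pdivlMl ?mulr_gt0// mulr1.
- move=> x /outer; rewrite /aff addrK normrZ gtr0_norm// => xr.
  by rewrite -(ler_pM2l R0) mulr1 ltW.
Qed.

(** * Limits along an ultrafilter *)

Section ultralimit.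
Context {R : realType} {n : nat}.
Local Notation E := 'rV[R]_n.
Local Notation mu := (lebesgue_rV R n).
Implicit Types (x y z v g : E) (s t : R) (Omega : set E).
Context (U : set_system (set E)) (UU : UltraFilter U) (r : R) (r0 : 0 < r).
Context (Ur : U [set Omega | normalised r Omega]).

Let PU : ProperFilter U := ultra_proper.

(* The limit along [U] of domains of which a fixed ball is a subset: the role
   of a subsequential Hausdorff limit in the Blaschke selection theorem. *)
Definition ultralimit : set E :=
  [set x | exists2 d, 0 < d & U [set Omega | forall y, `|y - x| < d -> Omega y]].

Lemma ultralimit_ball x : `|x| < r -> ultralimit x.
Proof.
move=> xr; exists (r - `|x|); first by rewrite subr_gt0.
apply: filterS Ur => Omega [_ Or _] y yx; apply: Or.
by have := ler_normD (y - x) x; rewrite subrK; lra.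
Qed.

Lemma ultralimit_le1 x : ultralimit x -> `|x| <= 1.
Proof.
move=> [d d0 Ud]; have := filter_ex (filterI Ud Ur).
by move=> [W [Wd [_ _ W1]]]; apply/W1/Wd; rewrite subrr normr0.
Qed.

Lemma convex_domain_ultralimit : convex_domain ultralimit.
Proof.
split.
- by exists 0; apply: ultralimit_ball; rewrite normr0.
- apply/open_rVP => x [d d0 Ud]; exists (d / 2); first by rewrite divr_gt0.
  move=> y yx; exists (d / 2); first by rewrite divr_gt0.
  apply: filterS Ud => Omega Od z zy; apply: Od.
  by have := ler_normD (z - y) (y - x); rewrite addrA subrK; lra.
- by apply/bounded_rVP; exists 1 => // x; exact: ultralimit_le1.
- apply/convex_setP => x y s [d d0 Ud] [e e0 Ue] s01.
  exists (Num.min d e); first by rewrite lt_min d0.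
  apply: filterS (filterI (filterI Ud Ue) Ur) => Omega [[Od Oe] [[_ _ _ /convex_setP cO] _ _]].
  move=> z; rewrite lt_min => /andP[zd ze].
  set w := s *: x + (1 - s) *: y in zd ze.
  have -> : z = s *: (x + (z - w)) + (1 - s) *: (y + (z - w)).
    rewrite -[LHS](subrK w) addrC; move: (z - w) => u.
    by apply/rowP => j; rewrite /w !mxE; ring.
  by apply: cO => //; [apply: Od|apply: Oe]; rewrite addrAC subrr add0r.
Qed.

Lemma normalised_ultralimit : normalised r ultralimit.
Proof.
split; [exact: convex_domain_ultralimit|exact: ultralimit_ball|exact: ultralimit_le1].
Qed.

(** The margin [eta = (1 - s) r] is split in three: the net is [eta / 3] fine, and a ball of radius
    [2 eta / 3] about a net point [f] fits in the margin of any [s *: x] near [f] and contains the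
    ball of radius [eta / 3] about it. In the second inclusion one factor [s] puts [f] into the
    limit, and thus into [Omega]; the other leads from [s *: f] back to [s ^+ 2 *: x] inside
    [Omega]. *)
Lemma ultralimit_sandwich s : 0 < s < 1 ->
  U [set Omega | (forall x, Omega x -> ultralimit (s *: x)) /\
                 (forall x, ultralimit x -> Omega (s ^+ 2 *: x))].
Proof.
move=> s01; have /andP[s0 s1] := s01; have s1' : 0 < 1 - s by rewrite subr_gt0.
pose eta := (1 - s) * r.
have eta0 : 0 < eta by rewrite mulr_gt0.
have eta30 : 0 < eta / 3 by rewrite divr_gt0.
have [F finF netF] := @finite_net R n 1 (eta / 3) eta30.
pose B (f : E) := [set Omega : set E | forall y, `|y - f| < 2 * (eta / 3) -> Omega y].
(* The members of [A f] agree with the verdict of [U] on [B f], and contain [f] if the limit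
   does. *)
pose A (f : E) : set (set E) := (if `[< U (B f) >] then B f else ~` B f) `&`
  (if `[< ultralimit f >] then [set Omega | Omega f] else setT).
have UA f : U (A f).
  apply: filterI.
    by case: asboolP => // UBf; case: (in_ultra_setVsetC (B f) UU).
  case: asboolP => [[d d0 Ud]|_]; last exact: filterT.
  by apply: filterS Ud => Omega; apply; rewrite subrr normr0.
have UF : U (\bigcap_(f in F) A f).
  by have /finite_fsetP[F' ->] := finF; apply: filter_bigI => f _; exact: UA.
have shrink Omega x y : normalised r Omega -> Omega x -> `|y - s *: x| < eta -> Omega y.
  by move=> [[_ _ _ cO] Or _] Ox; exact: homothety_sub.
have sle1 x : `|x| <= 1 -> `|s *: x| <= 1.
  by move=> x1; rewrite normrZ gtr0_norm// mulr_ile1// ltW.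
apply: filterS (filterI UF Ur) => Omega [OF nO]; have [_ _ O1] := nO.
split=> x.
  move=> Ox; have [f fF xf] := netF _ (sle1 _ (O1 _ Ox)).
  have BO : B f Omega.
    move=> y yf; apply: (shrink _ x) => //.
    have := ler_normB (y - f) (s *: x - f).
    by rewrite opprB addrA subrK; lra.
  (* [Omega] lies in both [B f] and [A f], so the verdict on [B f] was positive. *)
  have [+ _] := OF f fF; case: asboolP => // UBf _.
  exists (eta / 3) => //; apply: filterS UBf => Omega' Bf y yx; apply: Bf.
  by have := ler_normD (y - s *: x) (s *: x - f); rewrite addrA subrK; lra.
move=> Lx; have [f fF xf] := netF _ (sle1 _ (ultralimit_le1 Lx)).
have Lf : ultralimit f.
  apply: (shrink _ x) => //; first exact: normalised_ultralimit.
  by rewrite distrC; lra.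
have [_] := OF f fF; case: asboolP => // _ Of.
apply: (shrink _ f) => //.
rewrite expr2 -scalerA -scalerBr normrZ gtr0_norm//.
have : s * `|s *: x - f| <= `|s *: x - f| by rewrite ler_piMl// ltW.
by lra.
Qed.

End ultralimit.

Section limits_at_one.
Context {R : realType}.

Lemma exprV_addM (s : R) k l j : s ^- k * s ^- l ^+ j = s ^- (k + l * j).
Proof. by rewrite -!exprVn -exprM -exprD. Qed.

Lemma le_of_scaled (b c : R) k :
  (forall s : R, 0 < s < 1 -> b * s ^+ k <= c) -> b <= c.
Proof.
move=> H.
have C : (fun s : R => b * s ^+ k) @ 1^'- --> b.
  rewrite -[X in _ --> X](_ : b * 1 ^+ k = _); last by rewrite expr1n mulr1.
  apply: cvg_at_left_filter; apply: cvgM; first exact: cvg_cst.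
  exact: exprn_continuous.
apply: (cvgr_to_le C); near=> s; apply: H; apply/andP; split.
  by near: s; apply: nbhs_left_gt.
by near: s; exact: nbhs_left_lt.
Unshelve. all: by end_near. Qed.

Lemma exists_scale_small (c e : R) k l : 0 < e ->
  exists2 s : R, 0 < s < 1 & c * ((s ^+ k)^-1 - s ^+ l) < e.
Proof.
move=> e0.
have C : (fun s : R => c * ((s ^+ k)^-1 - s ^+ l)) @ 1^'- --> (0 : R).
  rewrite -[X in _ --> X](_ : c * ((1 ^+ k)^-1 - 1 ^+ l) = _); last first.
    by rewrite !expr1n invr1 subrr mulr0.
  apply: cvg_at_left_filter; apply: cvgM; first exact: cvg_cst.
  apply: cvgB; last exact: exprn_continuous.
  by apply: cvgV; [rewrite expr1n oner_eq0|exact: exprn_continuous].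
have H : \forall s \near 1^'-, c * ((s ^+ k)^-1 - s ^+ l) < e by exact: cvgr_lt C _ e0.
near (1 : R)^'- => s; exists s; last by near: s.
apply/andP; split; first by near: s; apply: nbhs_left_gt.
by near: s; exact: nbhs_left_lt.
Unshelve. all: by end_near. Qed.

End limits_at_one.

(** * Upper semicontinuity of [G] along the ultrafilter *)

Section semicontinuity.
Context {R : realType} {n : nat} (hn : (2 <= n)%N).
Local Notation E := 'rV[R]_n.
Local Notation mu := (lebesgue_rV R n).
Local Notation alpha := (n%:R / (n%:R - 1) : R).
Context (U : set_system (set E)) (UU : UltraFilter U) (r : R) (r0 : 0 < r).
Context (Ur : U [set Omega | normalised r Omega]).
Local Notation L := (ultralimit U).

Let PU : ProperFilter U := ultra_proper.

Let cL : convex_domain L := convex_domain_ultralimit UU r0 Ur.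
Let dL : bounded_domain L := convex_domain_bounded cL.

Let starL (s : R) x : 0 <= s <= 1 -> L x -> L (s *: x).
Proof.
move=> s01 Lx; have [_ _ _ /convex_setP cO] := cL.
rewrite -[_ *: _]addr0 -[X in _ + X](scaler0 _ (1 - s)); apply: cO => //.
by apply: (ultralimit_ball UU Ur); rewrite normr0.
Qed.

(** The field is fixed before [s]: the bound [M] on its divergence and its excess over [p] decide
    how close to 1 the factor [s] must be. *)
Lemma perimeter_ultralimit (p : R) : (p%:E < perimeter L)%E ->
  U [set Omega | (p%:E < perimeter Omega)%E].
Proof.
move=> /ereal_sup_gt[_ [psi [Cpsi kpsi npsi ->]]]; rewrite lte_fin => pI.
have Apsi : admissible psi by split.
have cf := continuous_divergence Apsi.
have kf := compact_support_divergence Apsi.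
have [M M0 fM] := continuous_compact_support_bounded cf kf.
have [mL V0 VE] := volume_gt0 dL; set V := fine _ in V0 VE.
have gap0 : 0 < \int[mu]_(x in L) divergence psi x - p by rewrite subr_gt0.
(* The volumes of [L / s] and [s ^+ 2 L] are [V / s ^+ n] and [s ^+ (2 * n) * V]; this is the error
   of [Rintegral_between] for them. *)
have [s s01 sgap] := exists_scale_small (2 * M * V) n (2 * n) gap0.
have /andP[s0 s1] := s01; have s20 : 0 < s ^+ 2 by rewrite exprn_gt0.
have sN0 : s != 0 by rewrite gt_eqF.
apply: filterS (filterI (ultralimit_sandwich UU r0 Ur s01) Ur).
move=> Omega [[OL LO] [cO _ _]].
have dO := convex_domain_bounded cO; have [mO _ _] := volume_gt0 dO.
(* [O'] is [L / s] and [I'] is [s ^+ 2 L]. The sandwich puts [Omega] between them, star-shapedness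
   about 0 does so for [L]. *)
pose O' : set E := aff s 0 @^-1` L.
pose I' : set E := aff (s ^+ 2)^-1 0 @^-1` L.
have si0 : 0 < (s ^+ 2)^-1 by rewrite invr_gt0.
have dO' : bounded_domain O' := bounded_domain_aff 0 s0 dL.
have dI' : bounded_domain I' := bounded_domain_aff 0 si0 dL.
have [mO' VO'0 VO'] := volume_gt0 dO'; have [mI' VI'0 VI'] := volume_gt0 dI'.
have VO'E : fine (mu O') = (s ^+ n)^-1 * V.
  have := lebesgue_aff 0 s0 mL; rewrite -/O' VO' VE -EFinM => -[->].
  by rewrite mulKf// expf_neq0.
have VI'E : fine (mu I') = s ^+ (2 * n) * V.
  have := lebesgue_aff 0 si0 mL; rewrite -/I' VI' VE -EFinM => -[->].
  by rewrite exprVn exprM mulVKf// !expf_neq0.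
have I'O : I' `<=` Omega.
  move=> x; rewrite /I'/= /aff addr0 => /LO.
  by rewrite scalerA divff ?scale1r// expf_neq0.
have O'O : Omega `<=` O' by move=> x /OL; rewrite /O'/= /aff addr0.
have I'L : I' `<=` L.
  move=> x; rewrite /I'/= /aff addr0 => /(@starL (s ^+ 2)).
  rewrite scalerA divff ?scale1r ?expf_neq0//; apply.
  by rewrite ltW//= exprn_ile1// ltW.
have LO' : L `<=` O'.
  move=> x Lx; rewrite /O'/= /aff addr0; apply: starL => //.
  by rewrite !ltW.
have := @Rintegral_between _ _ _ M I' Omega L O' cf kf fM mI' mO mL mO'.
rewrite VO' ltry VO'E VI'E => /(_ isT I'O I'L O'O LO').
rewrite /= ler_norml => /andP[lb _].
have : p < \int[mu]_(x in Omega) divergence psi x by lra.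
rewrite -lte_fin => /lt_le_trans; apply; exact: perimeter_ubound.
Qed.

Lemma G_ultralimit (b : R) : 0 < b -> U [set Omega | (b%:E < G Omega)%E] ->
  (b%:E <= G L)%E.
Proof.
move=> b0 Ub.
have [mL V0 VE] := volume_gt0 dL.
have T0 := torsion_ge0 dL; have L0 := first_eigenvalue_ge0 dL.
have TL0 : (0 <= torsion L * first_eigenvalue L)%E by rewrite mule_ge0.
have [q q0 qE] : exists2 q : R, 0 <= q &
    (torsion L * first_eigenvalue L = q%:E)%E.
  have := torsion_eigenvalue_le_volume dL; rewrite VE.
  by move: TL0; case: (_ * _)%E => // q; rewrite lee_fin => q0 _; exists q.
(* The inclusion of [W] in [L / s] costs [s ^- (n + 2)] in [T], that of [s ^+ 2 W'] with [W' = L] in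
   [W] costs [s ^- 4] in [Lambda]; together [s ^- (n + 6)]. *)
have main (s p : R) : 0 < s < 1 -> 0 < p -> (p%:E < perimeter L)%E ->
    b * s ^+ (n + 6) * p `^ alpha <= q.
  move=> s01 p0 pL; have /andP[s0 s1] := s01.
  have := filter_ex (filterI (filterI (ultralimit_sandwich UU r0 Ur s01) Ur)
    (filterI Ub (perimeter_ultralimit pL))).
  move=> [W [[[WL LW] [cW _ _]] [bW pW]]].
  have dW := convex_domain_bounded cW.
  have s20 : 0 < s ^+ 2 by rewrite exprn_gt0.
  have dL' := bounded_domain_aff 0 s0 dL.
  have dW' := bounded_domain_aff 0 s20 dW.
  have TW : (torsion W <= ((s ^+ n.+2)^-1)%:E * torsion L)%E.
    rewrite lee_pdivlMl ?exprn_gt0//; apply: le_trans (torsion_aff 0 s0 dL).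
    apply: lee_wpmul2l; first by rewrite lee_fin exprn_ge0// ltW.
    apply: torsion_subset => // x /WL.
    by rewrite /preimage/= /aff addr0.
  have LamW : (first_eigenvalue W <= ((s ^+ 2)^-1 ^+ 2)%:E * first_eigenvalue L)%E.
    apply: (le_trans (first_eigenvalue_aff 0 s20 dW)).
    apply: lee_wpmul2l; first by rewrite lee_fin exprn_ge0// invr_ge0 ltW.
    apply: first_eigenvalue_subset => // x /LW.
    by rewrite /preimage/= /aff addr0.
  have TLW : (torsion W * first_eigenvalue W <=
      ((s ^+ n.+2)^-1 * (s ^+ 2)^-1 ^+ 2 * q)%:E)%E.
    apply: (le_trans (lee_pmul (torsion_ge0 dW) (first_eigenvalue_ge0 dW) TW LamW)).
    by rewrite muleACA qE.
  have := lt_le_trans bW (G_le hn p0 dW TLW (ltW pW)).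
  have pa0 : 0 < p `^ alpha by rewrite powR_gt0.
  rewrite lte_fin ltr_pdivlMr// => H.
  have sk0 : 0 < s ^+ (n + 6) by rewrite exprn_gt0.
  rewrite -mulrA mulrCA -ler_pdivlMl//; apply: le_trans (ltW H) _.
  rewrite le_eqVlt; apply/orP; left; apply/eqP; congr (_ * q).
  have sN0 : s != 0 by rewrite gt_eqF.
  have -> : (n + 6)%N = (n.+2 + 4)%N by rewrite addSnnS addSnnS.
  exact: (exprV_addM s n.+2 2 2).
case PE : (perimeter L) (perimeter_gt0 hn dL) => [p0||]// p00.
- rewrite lte_fin in p00.
  have pa0 : 0 < p0 `^ alpha by rewrite powR_gt0.
  rewrite /G qE PE poweR_EFin inver gt_eqF// -EFinM lee_fin ler_pdivlMr//.
  (* [main] requires [p] strictly below the perimeter [p0]. The choice [p = s ^+ n / s * p0] costs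
     another [s ^+ n] by [expr_alpha], and then [s] tends to 1. *)
  apply: (@le_of_scaled _ _ _ (n + 6 + n)) => s s01; have /andP[s0 s1] := s01.
  have sn0 : 0 < s ^+ n / s by rewrite divr_gt0 ?exprn_gt0.
  have sn1 : s ^+ n / s < 1.
    by rewrite ltr_pdivrMr// mul1r ltr_iXnr.
  have := main s (s ^+ n / s * p0) s01 (mulr_gt0 sn0 p00).
  rewrite PE lte_fin gtr_pMl// => /(_ sn1).
  rewrite powRM ?(ltW sn0) ?(ltW p00)// expr_alpha// => H.
  by rewrite exprD; lra.
(* If the perimeter of [L] is infinite, [main] holds for every [p > 0]; the [p] chosen here makes
   its left side [q + 1], a contradiction. *)
- have s01 : 0 < (2^-1 : R) < 1 by lra.
  have c0 : 0 < b * 2^-1 ^+ (n + 6) by rewrite mulr_gt0// exprn_gt0// invr_gt0.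
  have y0 : 0 < (q + 1) / (b * 2^-1 ^+ (n + 6)) by rewrite divr_gt0// ltr_wpDl.
  have p0 : 0 < ((q + 1) / (b * 2^-1 ^+ (n + 6))) `^ alpha^-1 by rewrite powR_gt0.
  have := main _ _ s01 p0; rewrite PE ltry => /(_ isT).
  rewrite -powRrM mulVf ?gt_eqF ?alpha_gt0//.
  rewrite powRr1 ?(ltW y0)// [_ * (_ / _)]mulrC divfK ?gt_eqF//.
  by rewrite leNgt ltrDl ltr01.
Qed.

End semicontinuity.

(** * Infimum and maximum of [G] over convex domains *)

Theorem proposition1p2 (R : realType) (m : nat) (hm : (2 <= m)%N) :
  ereal_inf [set G Omega | Omega in @convex_domain R m] = 0%E /\
  exists Omega0 : set 'rV[R]_m,
    [/\ convex_domain Omega0, G Omega0 \is a fin_num &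
        ereal_sup [set G Omega | Omega in @convex_domain R m] = G Omega0].
Proof.
have i0 : 'I_m := Ordinal (leq_trans (isT : 0 < 2)%N hm).
split.
  apply/eqP; rewrite eq_le; apply/andP; split; last first.
    by apply/ereal_infP => _ [W /convex_domain_bounded dW <-]; exact: G_ge0.
  apply/lee_addgt0Pr => e e0; rewrite add0e.
  (* The volume is [e ^- m.-1] and the unit shift along [i0] is disjoint from the box, so that the
     bound of [G_le_shift] is exactly [e]. *)
  pose l i : R := if i == i0 then 1 else e^-1.
  have l0 i : 0 < l i by rewrite /l; case: ifP => _ //; rewrite invr_gt0.
  have cB := @convex_domain_open_box R m l l0.
  have dB := convex_domain_bounded cB.
  have shift x : open_box l x -> ~ open_box l (x + 1 *: delta_mx 0 i0).
    move=> /(_ i0) + /(_ i0); rewrite !mxE /l !eqxx/= mulr1.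
    by move=> /andP[? ?] /andP[? ?]; lra.
  apply: (@le_trans _ _ (G (open_box l))).
    by apply: ereal_inf_lbound; exists (open_box l).
  apply: (le_trans (G_le_shift hm dB ltr01 shift)).
  rewrite lebesgue_open_box//= expr1n mulr1 (bigD1 i0)//= /l eqxx mul1r.
  rewrite (eq_bigr (fun=> e^-1)); last by move=> i /negbTE ->.
  rewrite prodr_const cardC1 card_ord -exprVn invrK.
  by rewrite lee_fin expr_pred_powR.
set S := ereal_sup _.
have S_ub (W : set 'rV[R]_m) : convex_domain W -> (G W <= S)%E.
  by move=> cW; apply: ereal_sup_ubound; exists W.
have cB := @convex_domain_open_box R m (fun=> 1) (fun=> ltr01).
have S0 : (0 <= S)%E := le_trans (G_ge0 (convex_domain_bounded cB)) (S_ub _ cB).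
(* The limit argument starts from a positive level below [S]. If [S = 0], the unit cube attains it
   because [G] is nonnegative. *)
have [Sle0|Sgt0] := leP S 0%E.
  exists (open_box (fun=> 1)); split=> //; first by exact/G_fin_num/convex_domain_bounded.
  have S00 : S = 0%E by apply/eqP; rewrite eq_le Sle0.
  apply/eqP; rewrite eq_le S_ub// andbT S00.
  exact/G_ge0/convex_domain_bounded.
have [a a0 aS] : exists2 a : R, 0 < a & (a%:E < S)%E.
  case: S Sgt0 {S_ub S0} => [s||]// s0; last by exists 1; rewrite ?ltry.
  exists (s / 2); first by rewrite divr_gt0.
  by rewrite lte_fin; rewrite lte_fin in s0; lra.
have [r r0 norm] := normalise hm a0.
(* The superlevel sets of [G] for levels below [S] form a filter base. Levels are kept above [a] so
   that [normalise] serves all of them with one radius [r]. *)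
pose D := [set b : R | a <= b /\ (b%:E < S)%E].
pose B (b : R) : set (set 'rV[R]_m) :=
  [set W | normalised r W /\ (b%:E < G W)%E].
have FF : ProperFilter (filter_from D B).
  apply: filter_from_proper => [|b [ab bS]].
    apply: filter_from_filter; first by exists a; split.
    move=> b c [ab bS] [ac cS]; exists (Num.max b c).
      by split; [rewrite le_max ab|case: (leP b c)].
    by move=> W [nW]; rewrite EFin_max gt_max => /andP[? ?].
  have [_ [W cW <-] bW] := ereal_sup_gt bS.
  have abE : (a%:E <= b%:E)%E by rewrite lee_fin.
  have [W' nW' GW'] := norm W cW (le_lt_trans abE bW).
  by exists W'; split; [exact: nW'|exact: lt_le_trans bW GW'].
have [U [UU FU]] := ultraFilterLemma FF.
have Ur : U [set W | normalised r W].
  by apply: FU; exists a; [split|move=> W []].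
have cL := convex_domain_ultralimit UU r0 Ur.
exists (ultralimit U); split=> //; first exact/G_fin_num/convex_domain_bounded.
apply/eqP; rewrite eq_le S_ub// andbT leNgt; apply/negP => LS.
have Lfin := G_fin_num hm (convex_domain_bounded cL).
(* A level of the filter base strictly between [G] of the limit and [S], with [S] possibly infinite;
   [G_ultralimit] contradicts it. *)
have [b [ab bS Lb]] : exists b : R, [/\ a <= b, (b%:E < S)%E & (G (ultralimit U) < b%:E)%E].
  rewrite -(fineK Lfin) in LS *; move: (fine _) LS => g gS.
  have MS : ((Num.max g a)%:E < S)%E by case: (leP g a).
  clear -MS; case: S MS => [t||]// MS.
    rewrite lte_fin in MS; have [ga aa] : g <= Num.max g a /\ a <= Num.max g a.
      by rewrite !le_max !lexx orbT.
    by exists ((Num.max g a + t) / 2); split; rewrite ?lte_fin; lra.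
  exists (Num.max g a + 1); split; rewrite ?ltry// ?lte_fin.
    by rewrite ler_wpDr// le_max lexx orbT.
  by rewrite ltr_pwDr// le_max lexx.
have : (b%:E <= G (ultralimit U))%E.
  apply: (G_ultralimit hm UU r0 Ur); first exact: lt_le_trans ab.
  by apply: FU; exists b; [split|move=> W []].
by rewrite leNgt Lb.
Qed.
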